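(* Let $d\ge 3$, let $\mathbb{D}$ be the open unit disk in $\mathbb{C}$ and $\mathbb{D}^*=\mathbb{D}\setminus\{0\}$. For $k\in\{1,\dots,d\}$ let $\omega_k$ be a meromorphic $1$-form in $\mathbb{D}$ with pole of order $n_k$ at $0$, holomorphic elsewhere, and with real residue at $0$. Assume that the parametrization $$f:\mathbb{D}^*\to\mathbb{R}^d,\qquad f(z)=\operatorname{Re}\int^z(\omega_1,\dots,\omega_d)$$ is an immersion. Then the Gauss curvature $\mathcal{K}_0$ of the puncture $0$ is $$\mathcal{K}_0=-2\pi\bigl(\max_k n_k-1\bigr).$$
   Context: Pole orders are integers and may be non-positive: $n_k\le 0$ means that $\omega_k$ is holomorphic at $0$ with a zero of order $-n_k$. The real-residue condition makes $f$ single valued on $\mathbb{D}^*$ (up to an additive constant). $\mathbb{D}^*$ carries the Riemannian metric induced by $f$ from $\mathbb{R}^d$. The Gauss curvature of the puncture $0$ is $$\mathcal{K}_0=\lim_{r\to0}\int_{|z|=r}\kappa_g\,ds,$$ where $\kappa_g$ is the geodesic curvature in the induced metric of the circle $|z|=r$, traversed counterclockwise, with sign taken with respect to the normal obtained by rotating the tangent vector by $+90^\circ$ in the orientation given by $z$. Explicitly, with $z=re^{it}$, $c_r(t)=f(re^{it})$, one has $\int_{|z|=r}\kappa_g\,ds=\int_0^{2\pi}\frac{c_r''\cdot R^{90}c_r'}{|c_r'|^2}\,dt$, where $R^{90}$ is the rotation by $+90^\circ$ in the tangent plane of the surface oriented by $df$. Equivalently, $\mathcal{K}_0=\int_{D'}K\,dA+\int_{\partial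 D}\kappa_g\,ds$ for a coordinate disk $D$ about $0$, with $D'=D\setminus\{0\}$, $K$ the Gauss curvature and the area integral taken as an improper integral (limit over annuli $r<|z|$, $r\to0$). *)

(* Defs.v *)
From Stdlib Require Import Reals ZArith Lra.
From mathcomp Require Import all_boot.
From Coquelicot Require Import Coquelicot.

Set Implicit Arguments.
Unset Strict Implicit.
Unset Printing Implicit Defensive.

Local Open Scope R_scope.

Definition in_punctured_disk (z : C) : Prop := 0 < Cmod z < 1.

Definition circ (r t : R) : C := (r * cos t, r * sin t).

Definition Cpowz (z : C) (n : Z) : C :=
  match n with
  | Z0 => RtoC 1
  | Zpos p => Cpow z (Pos.to_nat p)
  | Zneg p => Cinv (Cpow z (Pos.to_nat p))
  end.

(* A 1-form omega = h(z) dz is represented by its coefficient h : C -> C.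
   Only the values of h on the punctured disk matter; h 0 is a dummy value. *)

Definition holomorphic_at (h : C -> C) (z : C) : Prop :=
  ex_derive (K := C_AbsRing) (V := C_NormedModule) h z.

(* h(z) = g(z) / z^n near 0 with g holomorphic and g(0) <> 0; n <= 0 means
   that h dz extends holomorphically to 0 with a zero of order -n.  In
   particular h is not identically zero near 0. *)
Definition pole_order_at0 (h : C -> C) (n : Z) : Prop :=
  exists (rho : R) (g : C -> C),
    [/\ 0 < rho,
        forall z : C, Cmod z < rho -> holomorphic_at g z,
        g (RtoC 0) <> RtoC 0 &
        forall z : C, 0 < Cmod z < rho -> h z = (g z * Cpowz z (- n))%C].

(* The contour integral of h dz over |z| = r, counterclockwise, equals
   2 pi i c for all small r > 0. *)
Definition is_residue_at0 (h : C -> C) (c : C) : Prop :=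
  at_right 0 (fun r : R =>
    is_RInt (V := C_R_NormedModule)
      (fun t : R => (h (circ r t) * (Ci * circ r t))%C) 0 (2 * PI)
      (RtoC (2 * PI) * Ci * c)%C).

(* f = Re \int^z h dz on the punctured disk: along every C^1 path gam in the
   punctured disk (with velocity dgam), f increases by the real part of the
   line integral.  This determines f up to an additive constant. *)
Definition is_re_integral (h : C -> C) (f : C -> R) : Prop :=
  forall gam dgam : R -> C,
    (forall t : R, 0 <= t <= 1 ->
       [/\ in_punctured_disk (gam t),
           is_derive (K := R_AbsRing) (V := C_R_NormedModule) gam t (dgam t) &
           continuous (T := R_UniformSpace) (U := C_UniformSpace) dgam t]) ->
    is_RInt (V := R_NormedModule)
      (fun t : R => Re (h (gam t) * dgam t)%C) 0 1 (f (gam 1) - f (gam 0)).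

Definition vec (d : nat) := 'I_d -> R.

Definition dot d (u v : vec d) : R := \big[Rplus/0]_(k < d) (u k * v k).

(* Partial derivatives of f : C -> R^d, with z = x + i y. *)
Definition f_x d (f : C -> vec d) (z : C) : vec d :=
  fun k => Derive (fun x : R => f (x, Im z) k) (Re z).
Definition f_y d (f : C -> vec d) (z : C) : vec d :=
  fun k => Derive (fun y : R => f (Re z, y) k) (Im z).

(* df_z (a, b) = a f_x + b f_y is injective at every z. *)
Definition is_immersion d (f : C -> vec d) : Prop :=
  forall z : C, in_punctured_disk z ->
  forall a b : R,
    (forall k, a * f_x f z k + b * f_y f z k = 0) -> a = 0 /\ b = 0.

(* Rotation by +90 degrees of v in the plane spanned by X and Y, oriented by
   (X, Y); see rot90_spec. *)
Definition rot90 d (X Y v : vec d) : vec d :=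
  fun k => (dot v X * Y k - dot v Y * X k)
           / sqrt (dot X X * dot Y Y - dot X Y ^ 2).

Lemma dotC d (u v : vec d) : dot u v = dot v u.
Proof. by apply: eq_bigr => k _; rewrite Rmult_comm. Qed.

Lemma dot_linear d (u v w : vec d) (a b : R) :
  dot (fun k => a * u k + b * v k) w = a * dot u w + b * dot v w.
Proof.
rewrite /dot; elim: (index_enum _) => [|k s IH]; first by rewrite !big_nil; lra.
rewrite !big_cons IH.
set su := \big[_/_]_(j <- s) (u j * w j).
set sv := \big[_/_]_(j <- s) (v j * w j).
set uk := u k; set vk := v k; set wk := w k.
by ring.
Qed.

Lemma rot90_spec d (X Y : vec d) (a b : R) :
  0 < dot X X * dot Y Y - dot X Y ^ 2 ->
  let v : vec d := fun k => a * X k + b * Y k in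
  let w := rot90 X Y v in
  [/\ dot w v = 0,
      dot w w = dot v v &
      exists a' b' : R,
        (forall k, w k = a' * X k + b' * Y k) /\
        (a <> 0 \/ b <> 0 -> 0 < a * b' - b * a')].
Proof.
move=> hD v w.
set E := dot X X in hD *; set G := dot Y Y in hD *; set F := dot X Y in hD *.
have hs := sqrt_lt_R0 _ hD.
have hs2 := sqrt_sqrt _ (Rlt_le _ _ hD).
set W := sqrt _ in hs hs2.
pose a' := - (a * F + b * G) / W; pose b' := (a * E + b * F) / W.
have vX : dot v X = a * E + b * F by rewrite dot_linear (dotC Y X).
have vY : dot v Y = a * F + b * G by rewrite dot_linear.
have hw k : w k = a' * X k + b' * Y k.
  by rewrite /w /rot90 vX vY -/E -/F -/G -/W /a' /b'; field; lra.
have wd u : dot w u = a' * dot X u + b' * dot Y u.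
  by rewrite -dot_linear; apply: eq_bigr => k _; rewrite hw.
have vv : dot v v = a * a * E + 2 * (a * b) * F + b * b * G.
  by rewrite dot_linear !(dotC _ v) vX vY; ring.
split.
- by rewrite wd !(dotC _ v) vX vY /a' /b'; field; lra.
- rewrite wd !(dotC _ w) !wd -/E -/F -/G (dotC Y X) -/F vv.
  have -> : a' * (a' * E + b' * F) + b' * (a' * F + b' * G)
     = (E * G - F ^ 2) * (a * a * E + 2 * (a * b) * F + b * b * G) / (W * W).
    by rewrite /a' /b'; field; lra.
  by rewrite hs2; field; lra.
- exists a', b'; split=> // hab.
  have -> : a * b' - b * a' = (a * a * E + 2 * (a * b) * F + b * b * G) / W.
    by rewrite /a' /b'; field; lra.
  apply: Rdiv_lt_0_compat => //.
  have hE : 0 <= E.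
    rewrite /E /dot; apply: (big_ind (fun x => 0 <= x)).
    - by lra.
    - by move=> x y; lra.
    - by move=> k _; apply: Rle_0_sqr.
  have {}hE : 0 < E.
    by case: hE => // hE; move: hD; rewrite -hE; have := pow2_ge_0 F; lra.
  have hq : E * (a * a * E + 2 * (a * b) * F + b * b * G)
     = (a * E + b * F) ^ 2 + b ^ 2 * (E * G - F ^ 2) by ring.
  apply: (Rmult_lt_reg_l E) => //; rewrite Rmult_0_r hq.
  have h1 := pow2_ge_0 (a * E + b * F).
  case: (Req_dec b 0) => hb.
  + have ha : a <> 0 by case: hab.
    have : 0 < (a * E) ^ 2.
      by apply: pow2_gt_0; apply: Rmult_integral_contrapositive; split=> //; lra.
    by rewrite hb; lra.
  + by have := Rmult_lt_0_compat _ _ (pow2_gt_0 _ hb) hD; lra.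
Qed.

(* The integrand kappa_g ds of the circle c_r(t) = f(r e^{it}), i.e.
   (c_r'' . R90 c_r') / |c_r'|^2, R90 being the rotation in the tangent plane
   of the surface oriented by (f_x, f_y). *)
Definition geodesic_curvature_density d (f : C -> vec d) (r t : R) : R :=
  let c' : vec d := fun k => Derive (fun s => f (circ r s) k) t in
  let c'' : vec d := fun k => Derive_n (fun s => f (circ r s) k) 2 t in
  let z := circ r t in
  dot c'' (rot90 (f_x f z) (f_y f z) c') / dot c' c'.

(* K0 = lim_{r -> 0} of the total geodesic curvature of |z| = r. *)
Definition is_puncture_gauss_curvature d (f : C -> vec d) (K0 : R) : Prop :=
  at_right 0 (fun r : R =>
    ex_RInt (V := R_NormedModule) (geodesic_curvature_density f r) 0 (2 * PI)) /\
  filterlim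
    (fun r : R => RInt (geodesic_curvature_density f r) 0 (2 * PI))
    (at_right 0) (locally K0).

Definition is_max d (n : 'I_d -> Z) (N : Z) : Prop :=
  (forall k, (n k <= N)%Z) /\ exists k, n k = N.

(* Main.v *)
Require Import Defs.
From Stdlib Require Import Reals ZArith Lra Lia ClassicalEpsilon FunctionalExtensionality.
From mathcomp Require Import all_boot.
From Coquelicot Require Import Coquelicot.
Local Open Scope R_scope.

(** Write [omega_k = h_k dz], so that [f_x = Re h] and [f_y = - Im h], and let
    [h_0] be a coefficient whose pole has the maximal order [N].  The quotients
    [Q_k = h_k / h_0] are holomorphic at the puncture, and [h_0 = z^(-N) g] with
    [g] holomorphic and [g 0 <> 0].  With the vectors [P = Re Q] and
    [S = - Im Q], the velocity of the image of the circle [z = r e^(it)] is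
    [X P + Y S], where [X + i Y = i z h_0 = i z^(1 - N) g].

    The vector [P] extends continuously to the puncture and does not vanish
    there, since the component of [Q] that belongs to [h_0] is 1.  So it can be
    normalized to the first vector [E1] of a moving orthonormal frame
    [(E1, E2)] of the tangent planes, even where those planes degenerate in the
    limit.  The geodesic curvature of the circle splits into two rotations.

    - The frame rotates at the speed [<E1', E2>], which is at most
      [|P'| = O(r)].

    - In the frame, the tangent vector makes as many turns as [X + i Y], because
      the coordinates of [X P + Y S] arise from [(X, Y)] by an upper triangular
      matrix with positive diagonal ([frame_total_curvature]).  The argument of
      [X + i Y] rotates at the speed [1 - N + Re (z g'/g) = 1 - N + O(r)].

    Hence the total geodesic curvature of the circle of radius [r] is
    [2 pi (1 - N) + O(r)] ([circle_total_curvature]).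

    This uses continuity of the complex derivatives of [g] and [Q], both to
    integrate the curvature and to bound the error terms.  Holomorphy only means
    complex differentiability at each point, so continuity of the derivative
    comes from Goursat's lemma: it makes the circle means of a difference
    quotient independent of the radius, which expresses the derivative at a
    point by the values of the function on a circle of fixed radius
    ([derivative_circle_integral], [C_derive_continuous]). *)

(** * Goursat's lemma for closed forms on a rectangle *)

(* Integrals produce equations whose type is a structure over R rather than R
   itself. *)
Ltac ring_R :=
  match goal with |- @eq _ ?x ?y => change (@eq R x y) end; ring.

(** The induction behind Goursat's lemma: a property of rectangles that passes
    from the four quarters to the whole holds as soon as it holds for all small
    rectangles around each point.  Otherwise successive bad quarters would
    shrink to a point. *)
Lemma rectangle_bisection (P : R -> R -> R -> R -> Prop) (s1 s2 t1 t2 : R) :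
  s1 <= s2 -> t1 <= t2 ->
  (forall a b c d, s1 <= a <= b -> b <= s2 -> t1 <= c <= d -> d <= t2 ->
     let m := (a + b) / 2 in let n := (c + d) / 2 in
     P a m c n -> P m b c n -> P a m n d -> P m b n d -> P a b c d) ->
  (forall x y, s1 <= x <= s2 -> t1 <= y <= t2 ->
     exists2 del, 0 < del & forall a b c d,
       s1 <= a <= x -> x <= b <= s2 -> t1 <= c <= y -> y <= d <= t2 ->
       b - a < del -> d - c < del -> P a b c d) ->
  P s1 s2 t1 t2.
Proof.
move=> hs ht split4 small; apply: NNPP => nP.
pose w n := (s2 - s1) / 2 ^ n; pose v n := (t2 - t1) / 2 ^ n.
have p2 n : 0 < 2 ^ n by apply: pow_lt; lra.
have wS n : w n.+1 = w n / 2 by rewrite /w /=; field; have := p2 n; lra.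
have vS n : v n.+1 = v n / 2 by rewrite /v /=; field; have := p2 n; lra.
have w0 n : 0 <= w n by apply: Rdiv_le_0_compat => //; lra.
have v0 n : 0 <= v n by apply: Rdiv_le_0_compat => //; lra.
pose Q n (z : R * R) := P z.1 (z.1 + w n) z.2 (z.2 + v n).
pose step n (z : R * R) : R * R :=
  let x := z.1 + w n.+1 in let y := z.2 + v n.+1 in
  if excluded_middle_informative (Q n.+1 z) then
    if excluded_middle_informative (Q n.+1 (x, z.2)) then
      if excluded_middle_informative (Q n.+1 (z.1, y)) then (x, y)
      else (z.1, y)
    else (x, z.2)
  else z.
pose z := fix z n := if n is n'.+1 then step n' (z n') else (s1, t1).
have inv n : [/\ s1 <= (z n).1, (z n).1 + w n <= s2, t1 <= (z n).2,
                 (z n).2 + v n <= t2 & ~ Q n (z n)].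
  elim: n => [|n [h1 h2 h3 h4 h5]].
    split=> //=; try lra; rewrite /w /v /=; try lra.
    by rewrite /Q /w /v /= => H; apply: nP; move: H; congr P; field.
  have hw := w0 n; have hv := v0 n; have hwS := wS n; have hvS := vS n.
  have := split4 (z n).1 ((z n).1 + w n) (z n).2 ((z n).2 + v n).
  move=> /(_ ltac:(lra) ltac:(lra) ltac:(lra) ltac:(lra)) /=.
  have -> : ((z n).1 + ((z n).1 + w n)) / 2 = (z n).1 + w n.+1 by lra.
  have -> : ((z n).2 + ((z n).2 + v n)) / 2 = (z n).2 + v n.+1 by lra.
  have Ew : (z n).1 + w n = (z n).1 + w n.+1 + w n.+1 by lra.
  have Ev : (z n).2 + v n = (z n).2 + v n.+1 + v n.+1 by lra.
  move: h5; rewrite /Q Ew Ev => h5 hs4 /=; rewrite /step.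
  repeat case: excluded_middle_informative; rewrite /Q /= => q1 q2 q3;
    split=> //=; try lra.
  by move=> q4; apply: h5; apply: hs4.
have mono n : (z n).1 <= (z n.+1).1 /\ (z n).2 <= (z n.+1).2.
  have := w0 n.+1; have := v0 n.+1.
  rewrite /= /step; repeat case: excluded_middle_informative => ? /=; split; lra.
have mono' n : (z n.+1).1 + w n.+1 <= (z n).1 + w n
            /\ (z n.+1).2 + v n.+1 <= (z n).2 + v n.
  have := w0 n; have := v0 n; have := wS n; have := vS n.
  rewrite [z n.+1]/= /step; repeat case: excluded_middle_informative => ? /=; split; lra.
(* The corners increase and the opposite corners decrease to a common point. *)
have geo c : is_lim_seq (fun n => c / 2 ^ n) 0.
  apply: (is_lim_seq_ext (fun n => c * (/ 2) ^ n)).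
    by move=> n; rewrite pow_inv.
  rewrite -(Rmult_0_r c); apply: (is_lim_seq_scal_l _ c (Finite 0)).
  by apply: is_lim_seq_geom; rewrite Rabs_pos_eq; lra.
have [x hx] : ex_finite_lim_seq (fun n => (z n).1).
  apply: (ex_finite_lim_seq_incr _ s2) => n; first by case: (mono n).
  by case: (inv n) => *; have := w0 n; lra.
have [y hy] : ex_finite_lim_seq (fun n => (z n).2).
  apply: (ex_finite_lim_seq_incr _ t2) => n; first by case: (mono n).
  by case: (inv n) => *; have := v0 n; lra.
have lx n : (z n).1 <= x by apply: (is_lim_seq_incr_compare _ _ hx) => k; case: (mono k).
have ly n : (z n).2 <= y by apply: (is_lim_seq_incr_compare _ _ hy) => k; case: (mono k).
have ux n : x <= (z n).1 + w n.
  apply: (is_lim_seq_decr_compare (fun n => (z n).1 + w n)) => [|k]; last by case: (mono' k).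
  by rewrite -(Rplus_0_r x); apply: is_lim_seq_plus' => //; apply: geo.
have uy n : y <= (z n).2 + v n.
  apply: (is_lim_seq_decr_compare (fun n => (z n).2 + v n)) => [|k]; last by case: (mono' k).
  by rewrite -(Rplus_0_r y); apply: is_lim_seq_plus' => //; apply: geo.
have xin : s1 <= x <= s2 by have := lx 0%N; have := ux 0%N; rewrite /w /=; lra.
have yin : t1 <= y <= t2 by have := ly 0%N; have := uy 0%N; rewrite /v /=; lra.
have [del del0 hdel] := small x y xin yin.
have [n1 hn1] : exists n, w n < del /\ v n < del.
  have /is_lim_seq_spec /(_ (mkposreal _ del0)) [n1 h1] := geo (s2 - s1).
  have /is_lim_seq_spec /(_ (mkposreal _ del0)) [n2 h2] := geo (t2 - t1).
  exists (Nat.max n1 n2).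
  have /= := h1 (Nat.max n1 n2) (Nat.le_max_l _ _).
  have /= := h2 (Nat.max n1 n2) (Nat.le_max_r _ _).
  rewrite !Rminus_0_r -/(w _) -/(v _) !Rabs_pos_eq //; lra.
case: (inv n1) => i1 i2 i3 i4; apply.
have := lx n1; have := ux n1; have := ly n1; have := uy n1 => ? ? ? ?.
by apply: hdel; lra.
Qed.

Lemma RInt_near_const (g : R -> R) (c K x y : R) :
  x <= y -> (forall t, x <= t <= y -> continuous g t) ->
  (forall t, x <= t <= y -> Rabs (g t - c) <= K) ->
  Rabs (RInt g x y - c * (y - x)) <= K * (y - x).
Proof.
move=> xy cg hK.
have eg : ex_RInt g x y.
  by apply: ex_RInt_continuous => t; rewrite Rmin_left // Rmax_right //; apply: cg.
have ec : ex_RInt (fun _ => c) x y by apply: ex_RInt_const.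
have -> : RInt g x y - c * (y - x) = RInt (fun t => minus (g t) c) x y.
  rewrite RInt_minus // RInt_const /minus /plus /opp /scal /= /mult /=; ring.
rewrite Rmult_comm; apply: abs_RInt_le_const => //.
by apply: ex_RInt_minus.
Qed.

Lemma differentiable_pt_lim_continuous (a : R -> R -> R) (s t p q : R) :
  differentiable_pt_lim a s t p q ->
  continuous (fun x => a x t) s /\ continuous (a s) t.
Proof.
move=> h; split; apply: ex_derive_continuous; [exists p|exists q];
  apply/is_derive_Reals.
- have := derivable_pt_lim_comp_2d _ _ _ s _ _ _ _ h
    (derivable_pt_lim_id s) (derivable_pt_lim_const t s).
  by rewrite Rmult_1_r Rmult_0_r Rplus_0_r.
- have := derivable_pt_lim_comp_2d _ _ (fun x => x) t _ _ _ _ h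
    (derivable_pt_lim_const s t) (derivable_pt_lim_id t).
  by rewrite Rmult_1_r Rmult_0_r Rplus_0_l.
Qed.

(** The integral of [a ds + b dt] along the boundary, counterclockwise. *)
Definition rect_circulation (a b : R -> R -> R) (s1 s2 t1 t2 : R) : R :=
  RInt (fun s => a s t1 - a s t2) s1 s2 + RInt (fun t => b s2 t - b s1 t) t1 t2.

Lemma continuousB (u v : R -> R) (x : R) :
  continuous u x -> continuous v x -> continuous (fun x => u x - v x) x.
Proof. by move=> hu hv; apply: (continuous_minus (V := R_NormedModule)). Qed.

Lemma RIntD (u v : R -> R) (x y : R) :
  ex_RInt u x y -> ex_RInt v x y ->
  RInt (fun t => u t + v t) x y = RInt u x y + RInt v x y.
Proof. exact: RInt_plus. Qed.

(** Only differentiability of the coefficients at each point is assumed, so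
    Green's formula is not available.  On a small rectangle the affine part of
    the form contributes nothing, being closed, and the remainder is small
    compared with the square of the perimeter, a bound that is additive under
    division into four quarters. *)
Lemma goursat_rectangle (a b : R -> R -> R) (s1 s2 t1 t2 : R) :
  s1 <= s2 -> t1 <= t2 ->
  (forall s t, s1 <= s <= s2 -> t1 <= t <= t2 -> exists p q m,
     differentiable_pt_lim a s t p q /\ differentiable_pt_lim b s t q m) ->
  rect_circulation a b s1 s2 t1 t2 = 0.
Proof.
move=> hs ht hD.
have ca s t : s1 <= s <= s2 -> t1 <= t <= t2 -> continuous (fun x => a x t) s.
  by move=> /hD H /H[p [q [m [/differentiable_pt_lim_continuous[] //]]]].
have cb s t : s1 <= s <= s2 -> t1 <= t <= t2 -> continuous (b s) t.
  by move=> /hD H /H[p [q [m [_ /differentiable_pt_lim_continuous[] //]]]].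
have ia x y c d : s1 <= x <= s2 -> s1 <= y <= s2 -> t1 <= c <= t2 ->
    t1 <= d <= t2 -> ex_RInt (fun s => a s c - a s d) x y.
  move=> hx hy hc hd; apply: ex_RInt_continuous => s hxy.
  have hss : s1 <= s <= s2.
    by move: hxy; rewrite /Rmin /Rmax; case: Rle_dec; lra.
  by apply: continuousB; apply: ca.
have ib x y c d : t1 <= x <= t2 -> t1 <= y <= t2 -> s1 <= c <= s2 ->
    s1 <= d <= s2 -> ex_RInt (fun t => b c t - b d t) x y.
  move=> hx hy hc hd; apply: ex_RInt_continuous => t hxy.
  have hss : t1 <= t <= t2.
    by move: hxy; rewrite /Rmin /Rmax; case: Rle_dec; lra.
  by apply: continuousB; apply: cb.
have small eps : 0 < eps ->
    Rabs (rect_circulation a b s1 s2 t1 t2) <= 2 * eps * (s2 - s1 + (t2 - t1)) ^ 2.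
  move=> eps0.
  pose P x y c d :=
    Rabs (rect_circulation a b x y c d) <= 2 * eps * (y - x + (d - c)) ^ 2.
  apply: (rectangle_bisection P) => // [x y c d hx hy hc hd m n|s t hss htt].
    have hm : x <= m <= y by rewrite /m; lra.
    have hn : c <= n <= d by rewrite /n; lra.
    have -> : P x y c d <-> Rabs (rect_circulation a b x m c n
       + rect_circulation a b m y c n + rect_circulation a b x m n d
       + rect_circulation a b m y n d) <= 2 * eps * (y - x + (d - c)) ^ 2.
      suff -> : rect_circulation a b x m c n
       + rect_circulation a b m y c n + rect_circulation a b x m n d
       + rect_circulation a b m y n d = rect_circulation a b x y c d by [].
      rewrite /rect_circulation.
      rewrite -(RInt_Chasles _ x m y); [|by apply: ia; lra|by apply: ia; lra].
      rewrite -(RInt_Chasles _ c n d); [|by apply: ib; lra|by apply: ib; lra].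
      rewrite /plus /=.
      have ea u v : s1 <= u <= s2 -> s1 <= v <= s2 ->
        RInt (fun s => a s c - a s d) u v
        = RInt (fun s => a s c - a s n) u v + RInt (fun s => a s n - a s d) u v.
        move=> hu hv; rewrite -RIntD; [|by apply: ia; lra|by apply: ia; lra].
        by apply: RInt_ext => s _; ring_R.
      have eb u v : t1 <= u <= t2 -> t1 <= v <= t2 ->
        RInt (fun t => b y t - b x t) u v
        = RInt (fun t => b m t - b x t) u v + RInt (fun t => b y t - b m t) u v.
        move=> hu hv; rewrite -RIntD; [|by apply: ib; lra|by apply: ib; lra].
        by apply: RInt_ext => t _; ring_R.
      have -> := ea x m ltac:(lra) ltac:(lra); have -> := ea m y ltac:(lra) ltac:(lra).
      have -> := eb c n ltac:(lra) ltac:(lra); have -> := eb n d ltac:(lra) ltac:(lra).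
      ring.
    rewrite /P.
    have -> : m - x = (y - x) / 2 by rewrite /m; field.
    have -> : y - m = (y - x) / 2 by rewrite /m; field.
    have -> : n - c = (d - c) / 2 by rewrite /n; field.
    have -> : d - n = (d - c) / 2 by rewrite /n; field.
    have -> : 2 * eps * ((y - x) / 2 + (d - c) / 2) ^ 2
            = 2 * eps * (y - x + (d - c)) ^ 2 / 4 by field.
    move=> p1 p2 p3 p4.
    apply: Rle_trans; first exact: Rabs_triang.
    have := Rabs_triang (rect_circulation a b x m c n) (rect_circulation a b m y c n).
    have := Rabs_triang (rect_circulation a b x m c n
       + rect_circulation a b m y c n) (rect_circulation a b x m n d).
    lra.
  have [p [q [m [da db]]]] := hD s t hss htt.
  have [d1 h1] := da (mkposreal _ eps0).
  have [d2 h2] := db (mkposreal _ eps0).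
  exists (Rmin d1 d2); first by apply: Rmin_glb_lt; apply: cond_pos.
  move=> x y c d hx hy hc hd w v; rewrite /P.
  have m1 := Rmin_l d1 d2; have m2 := Rmin_r d1 d2.
  have far u z : x <= u <= y -> c <= z <= d ->
      Rmax (Rabs (u - s)) (Rabs (z - t)) <= y - x + (d - c).
    by move=> hu hz; apply: Rmax_lub; apply: Rabs_le; lra.
  have ea u z : x <= u <= y -> c <= z <= d ->
      Rabs (a u z - a s t - (p * (u - s) + q * (z - t))) <= eps * (y - x + (d - c)).
    move=> hu hz; apply: Rle_trans (Rmult_le_compat_l _ _ _ (Rlt_le _ _ eps0) (far u z hu hz)).
    by apply: h1; apply: Rabs_def1; lra.
  have eb u z : x <= u <= y -> c <= z <= d ->
      Rabs (b u z - b s t - (q * (u - s) + m * (z - t))) <= eps * (y - x + (d - c)).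
    move=> hu hz; apply: Rle_trans (Rmult_le_compat_l _ _ _ (Rlt_le _ _ eps0) (far u z hu hz)).
    by apply: h2; apply: Rabs_def1; lra.
  set K := eps * (y - x + (d - c)) in ea eb *.
  have Ia := RInt_near_const (fun u => a u c - a u d) (q * (c - d)) (2 * K) x y.
  have {Ia} : Rabs (RInt (fun u => a u c - a u d) x y - q * (c - d) * (y - x))
      <= 2 * K * (y - x).
    apply: Ia; first lra.
      by move=> u hu; apply: continuousB; apply: ca; lra.
    move=> u hu; move: (ea u c ltac:(lra) ltac:(lra)) (ea u d ltac:(lra) ltac:(lra)).
    by move=> /Rabs_le_between e1 /Rabs_le_between e2; apply: Rabs_le; lra.
  have Ib := RInt_near_const (fun t => b y t - b x t) (q * (y - x)) (2 * K) c d.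
  have {Ib} : Rabs (RInt (fun t => b y t - b x t) c d - q * (y - x) * (d - c))
      <= 2 * K * (d - c).
    apply: Ib; first lra.
      by move=> u hu; apply: continuousB; apply: cb; lra.
    move=> u hu; move: (eb y u ltac:(lra) ltac:(lra)) (eb x u ltac:(lra) ltac:(lra)).
    by move=> /Rabs_le_between e1 /Rabs_le_between e2; apply: Rabs_le; lra.
  rewrite /rect_circulation => /Rabs_le_between i1 /Rabs_le_between i2.
  have -> : 2 * eps * (y - x + (d - c)) ^ 2 = 2 * K * (y - x) + 2 * K * (d - c).
    by rewrite /K; ring.
  by apply: Rabs_le; lra.
case: (Req_dec (rect_circulation a b s1 s2 t1 t2) 0) => // nz.
have h0 := Rabs_pos_lt _ nz.
(* Adding 1 keeps the divisor positive for a rectangle reduced to a point. *)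
set L := 2 * (s2 - s1 + (t2 - t1)) ^ 2 + 1.
have L0 : 0 < L by rewrite /L; have := pow2_ge_0 (s2 - s1 + (t2 - t1)); lra.
have e0 := Rdiv_lt_0_compat _ _ h0 L0.
have := small _ e0.
set A := Rabs _ in h0 e0 *.
have -> : 2 * (A / L) * (s2 - s1 + (t2 - t1)) ^ 2 = A - A / L.
  have -> : 2 * (A / L) * (s2 - s1 + (t2 - t1)) ^ 2 = A / L * (L - 1) by rewrite /L; ring.
  by field; lra.
lra.
Qed.

(** * Complex differentiability *)

Local Notation is_Cderive :=
  (is_derive (K := C_AbsRing) (V := C_NormedModule)).

Lemma Cmod_opp_sub (z w : C) : Cmod (z - w) = Cmod (w - z).
Proof. by rewrite -Cmod_opp; congr Cmod; ring. Qed.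

Lemma is_Cderive_eps (f : C -> C) (z l : C) :
  is_Cderive f z l <->
  (forall eps : R, 0 < eps -> exists2 del : R, 0 < del &
     forall w : C, Cmod (w - z) < del ->
       Cmod (f w - f z - (w - z) * l) <= eps * Cmod (w - z)).
Proof.
split=> [[_ h] eps eps0|h].
  have [del hdel] := h z (fun _ P => P) (mkposreal _ eps0).
  exists del; first exact: cond_pos.
  by move=> w hw; apply: hdel.
split; first exact: is_linear_scal_l.
move=> x /is_filter_lim_locally_unique <- eps.
have [del del0 hdel] := h eps (cond_pos eps).
by exists (mkposreal _ del0) => w hw; apply: hdel.
Qed.


Lemma Cmod_le_Rmax (x y : R) : Cmod (x, y) <= 2 * Rmax (Rabs x) (Rabs y).
Proof.
apply: Rle_trans (Cmod_2Rmax (x, y)) _; apply: Rmult_le_compat_r.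
  by apply: Rle_trans (Rmax_l _ _); apply: Rabs_pos.
have := sqrt_sqrt 2 ltac:(lra); have := sqrt_pos 2; nra.
Qed.

Lemma im_le_Cmod (z : C) : Rabs (Im z) <= Cmod z.
Proof. by apply: Rle_trans (Rmax_Cmod z); apply: Rmax_r. Qed.

(** The Cauchy-Riemann equations. *)
Lemma is_Cderive_differentiable (f : C -> C) (z l : C) : is_Cderive f z l ->
  differentiable_pt_lim (fun x y => Re (f (x, y))) (Re z) (Im z) (Re l) (- Im l) /\
  differentiable_pt_lim (fun x y => Im (f (x, y))) (Re z) (Im z) (Im l) (Re l).
Proof.
case: z => x y /is_Cderive_eps h.
have main (eps : posreal) : locally_2d (fun u v =>
    Cmod (f (u, v) - f (x, y) - ((u, v) - (x, y)) * l)
    <= eps * Rmax (Rabs (u - x)) (Rabs (v - y))) x y.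
  have [|del del0 hdel] := h (eps / 2); first by have := cond_pos eps; lra.
  have d2 : 0 < del / 2 by lra.
  exists (mkposreal _ d2) => u v /= hu hv.
  have m2 : Cmod ((u, v) - (x, y))%C <= 2 * Rmax (Rabs (u - x)) (Rabs (v - y)).
    exact: (Cmod_le_Rmax (u - x) (v - y)).
  have eps0 := cond_pos eps.
  have m3 : Rmax (Rabs (u - x)) (Rabs (v - y)) < del / 2 by apply: Rmax_lub_lt.
  apply: Rle_trans (hdel (u, v) _) _; first by apply: Rle_lt_trans m2 _; lra.
  by have := Rmult_le_compat_l _ _ _ (Rlt_le _ _ eps0) m2; lra.
split=> eps; have [del hdel] := main eps; exists del => u v hu hv;
  apply: Rle_trans (hdel u v hu hv).
- have -> : Re (f (u, v)) - Re (f (x, y)) - (Re l * (u - x) + - Im l * (v - y))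
     = Re (f (u, v) - f (x, y) - ((u, v) - (x, y)) * l)%C.
    by rewrite /Re /Im /=; ring.
  exact: re_le_Cmod.
- have -> : Im (f (u, v)) - Im (f (x, y)) - (Im l * (u - x) + Re l * (v - y))
     = Im (f (u, v) - f (x, y) - ((u, v) - (x, y)) * l)%C.
    by rewrite /Re /Im /=; ring.
  exact: im_le_Cmod.
Qed.

Lemma differentiable_pt_lim_separated (g1 g2 : R -> R) (s t l1 l2 : R) :
  is_derive g1 s l1 -> is_derive g2 t l2 ->
  differentiable_pt_lim (fun s t => g1 s * g2 t) s t (l1 * g2 t) (g1 s * l2).
Proof.
move=> /is_derive_Reals h1 /is_derive_Reals h2.
have p1 : differentiable_pt_lim (fun s _ => g1 s) s t l1 0.
  exact: differentiable_pt_lim_proj1_0.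
have p2 : differentiable_pt_lim (fun _ t => g2 t) s t 0 l2.
  have snd : differentiable_pt_lim (fun _ t => t) s t 0 1.
    move=> eps; exists (mkposreal _ Rlt_0_1) => u v _ _.
    have -> : v - t - (0 * (u - s) + 1 * (v - t)) = 0 by ring.
    rewrite Rabs_R0; apply: Rmult_le_pos; first exact: Rlt_le (cond_pos eps).
    by apply: Rle_trans (Rmax_l _ _); apply: Rabs_pos.
  have := differentiable_pt_lim_comp (fun x _ => g2 x) (fun _ y => y) (fun _ y => y)
    s t l2 0 0 1 0 1 (differentiable_pt_lim_proj1_0 _ _ _ _ h2) snd snd.
  by rewrite !Rmult_0_r !Rmult_0_l !Rplus_0_l Rplus_0_r Rmult_1_r.
have prod x y : differentiable_pt_lim Rmult x y y x.
  move=> eps; exists eps => u v hu hv.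
  have -> : u * v - x * y - (y * (u - x) + x * (v - y)) = (u - x) * (v - y) by ring.
  rewrite Rabs_mult; apply: Rmult_le_compat; try exact: Rabs_pos; first exact: Rlt_le.
  exact: Rmax_r.
have := differentiable_pt_lim_comp _ _ _ _ _ _ _ _ _ _ _ (prod (g1 s) (g2 t)) p1 p2.
by rewrite !Rmult_0_r Rplus_0_r Rplus_0_l Rmult_comm (Rmult_comm _ l2) Rmult_comm.
Qed.

Lemma differentiable_pt_lim_addl (c : R) (f : R -> R -> R) (s t p q : R) :
  differentiable_pt_lim f s t p q ->
  differentiable_pt_lim (fun s t => c + f s t) s t p q.
Proof.
move=> h eps; have [del hdel] := h eps; exists del => u v hu hv.
have -> : c + f u v - (c + f s t) = f u v - f s t by ring.
exact: hdel.
Qed.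

(** Precomposing with the exponential map, here written in polar form, keeps the
    Cauchy-Riemann equations: the derivative is multiplied by the value [w] of
    the exponential. *)
Lemma is_Cderive_comp_exp (k : C -> C) (z0 l : C) (s t : R) :
  let w := circ (exp s) t in
  is_Cderive k (z0 + w)%C l ->
  differentiable_pt_lim (fun s t => Re (k (z0 + circ (exp s) t)%C)) s t
    (Re (l * w)) (- Im (l * w)) /\
  differentiable_pt_lim (fun s t => Im (k (z0 + circ (exp s) t)%C)) s t
    (Im (l * w)) (Re (l * w)).
Proof.
move=> w /is_Cderive_differentiable [h1 h2].
have dexp : is_derive exp s (exp s) by apply/is_derive_Reals/derivable_pt_lim_exp.
have dcos : is_derive cos t (- sin t) by apply/is_derive_Reals/derivable_pt_lim_cos.
have dsin : is_derive sin t (cos t) by apply/is_derive_Reals/derivable_pt_lim_sin.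
have dx := differentiable_pt_lim_addl (Re z0) _ _ _ _ _
  (differentiable_pt_lim_separated _ _ _ _ _ _ dexp dcos).
have dy := differentiable_pt_lim_addl (Im z0) _ _ _ _ _
  (differentiable_pt_lim_separated _ _ _ _ _ _ dexp dsin).
have e1 := differentiable_pt_lim_comp _ _ _ _ _ _ _ _ _ _ _ h1 dx dy.
have e2 := differentiable_pt_lim_comp _ _ _ _ _ _ _ _ _ _ _ h2 dx dy.
have cast (f : R -> R -> R) p q p' q' : differentiable_pt_lim f s t p q ->
  p = p' -> q = q' -> differentiable_pt_lim f s t p' q' by move=> H <- <-.
by split; [apply: cast e1 _ _|apply: cast e2 _ _]; rewrite /w /circ /Re /Im /=; ring.
Qed.

(** The product rule and the chain rule are stated for [C] as a module over
    itself with the balls of the modulus, whereas [C_NormedModule] carries the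
    product balls. *)
Lemma is_Cderive_absring (f : C -> C) (z l : C) :
  is_Cderive f z l <->
  is_derive (K := C_AbsRing) (V := AbsRing_NormedModule C_AbsRing) f z l.
Proof.
split=> [[_ h]|[_ h]]; split=> //; exact: (@is_linear_scal_l C_AbsRing).
Qed.

Lemma is_Cderive_mult (f g : C -> C) (z df dg : C) :
  is_Cderive f z df -> is_Cderive g z dg ->
  is_Cderive (fun w => f w * g w)%C z (df * g z + f z * dg)%C.
Proof.
move=> /is_Cderive_absring hf /is_Cderive_absring hg; apply/is_Cderive_absring.
exact: (is_derive_mult f g z df dg hf hg Cmult_comm).
Qed.

Lemma is_Cderive_inv (z : C) : z <> 0 -> is_Cderive Cinv z (- / (z * z))%C.
Proof.
move=> z0; have hz : 0 < Cmod z by apply/Cmod_gt_0.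
apply/is_Cderive_eps => eps eps0.
(* The remainder is [(w - z)^2 / (w z^2)]; the first radius keeps [|w|] above
   [K / 2]. *)
set K := Cmod z in hz *; exists (Rmin (K / 2) (eps * K ^ 3 / 2)).
  apply: Rmin_glb_lt; first lra.
  by apply: Rdiv_lt_0_compat; [apply: Rmult_lt_0_compat => //; apply: pow_lt|lra].
move=> w hw.
have h1 := Rlt_le_trans _ _ _ hw (Rmin_l _ _).
have h2 := Rlt_le_trans _ _ _ hw (Rmin_r _ _).
have hwK : K / 2 < Cmod w.
  have := Cmod_triangle (z - w) w; rewrite Cmod_opp_sub.
  have -> : (z - w + w)%C = z by ring.
  by rewrite -/K; lra.
have w0 : w <> 0 by apply/Cmod_gt_0; lra.
have -> : (/ w - / z - (w - z) * - / (z * z))%C = ((w - z) * (w - z) / (w * z * z))%C.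
  by field.
rewrite /Cdiv Cmod_mult Cmod_inv; last first.
  by do 2 (apply: Cmult_neq_0 => //).
rewrite !Cmod_mult -/K.
have d0 : 0 < Cmod w * K * K by do 2 (apply: Rmult_lt_0_compat => //); lra.
apply: (Rmult_le_reg_r _ _ _ d0).
have -> : Cmod (w - z) * Cmod (w - z) * / (Cmod w * K * K) * (Cmod w * K * K)
          = Cmod (w - z) * Cmod (w - z) by field; lra.
rewrite Rmult_assoc Rmult_assoc (Rmult_comm eps) Rmult_assoc.
apply: Rmult_le_compat_l; first exact: Cmod_ge_0.
apply: Rle_trans (Rlt_le _ _ h2) _.
have -> : Cmod w * (K * K) * eps = eps * K ^ 2 * Cmod w by ring.
have -> : eps * K ^ 3 / 2 = eps * K ^ 2 * (K / 2) by field.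
by apply: Rmult_le_compat_l; [apply: Rmult_le_pos; nra|lra].
Qed.

Lemma holomorphic_mult (f g : C -> C) (z : C) :
  holomorphic_at f z -> holomorphic_at g z ->
  holomorphic_at (fun w => f w * g w)%C z.
Proof. by move=> [df hf] [dg hg]; eexists; apply: is_Cderive_mult hf hg. Qed.

Lemma holomorphic_inv (g : C -> C) (z : C) :
  g z <> 0 -> holomorphic_at g z -> holomorphic_at (fun w => / g w)%C z.
Proof.
move=> gz [dg hg]; exists (dg * (- / (g z * g z)))%C.
apply: (is_derive_comp (K := C_AbsRing) (V := C_NormedModule) Cinv g).
  exact: is_Cderive_inv.
exact/is_Cderive_absring.
Qed.

Lemma holomorphic_cst (c z : C) : holomorphic_at (fun _ => c) z.
Proof. by eexists; apply: (is_derive_const (K := C_AbsRing) (V := C_NormedModule)). Qed.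

Lemma holomorphic_id (z : C) : holomorphic_at (fun w => w) z.
Proof.
by eexists; apply/is_Cderive_absring; apply: (is_derive_id (K := C_AbsRing)).
Qed.

Lemma holomorphic_pow (m : nat) (z : C) : holomorphic_at (fun w => w ^ m)%C z.
Proof.
elim: m => [|m IH]; first exact: holomorphic_cst.
exact: (holomorphic_mult (fun w => w) (fun w => w ^ m)%C z (holomorphic_id z) IH).
Qed.

Lemma holomorphic_sub (f g : C -> C) (z : C) :
  holomorphic_at f z -> holomorphic_at g z ->
  holomorphic_at (fun w => f w - g w)%C z.
Proof.
move=> [df hf] [dg hg]; eexists.
exact: (is_derive_minus (K := C_AbsRing) (V := C_NormedModule)) hf hg.
Qed.

(** * Cauchy's formula at the center of a circle *)

Lemma circ_2PI (r : R) : circ r (2 * PI) = circ r 0.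
Proof. by rewrite /circ cos_2PI sin_2PI cos_0 sin_0. Qed.

Lemma Cmod_circ (r t : R) : 0 <= r -> Cmod (circ r t) = r.
Proof.
move=> r0; rewrite /Cmod /circ /=.
have -> : r * cos t * (r * cos t * 1) + r * sin t * (r * sin t * 1)
          = r * r * (Rsqr (sin t) + Rsqr (cos t)) by rewrite /Rsqr; ring.
by rewrite sin2_cos2 Rmult_1_r sqrt_square.
Qed.

Lemma circ_neq0 (r t : R) : 0 < r -> circ r t <> 0.
Proof. by move=> r0; apply/Cmod_gt_0; rewrite Cmod_circ; lra. Qed.

Lemma continuous_Re_circle (k : C -> C) (z0 : C) (r t : R) :
  0 < r -> holomorphic_at k (z0 + circ r t)%C ->
  continuous (fun t => Re (k (z0 + circ r t)%C)) t.
Proof.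
move=> r0 [l]; rewrite -(exp_ln r r0).
by move=> /is_Cderive_comp_exp [/differentiable_pt_lim_continuous []].
Qed.

Lemma exp_le_mono (x y : R) : x <= y -> exp x <= exp y.
Proof. by case=> [h|->]; [left; apply: exp_increasing|right]. Qed.

(** On the cylinder [s + i t], the form [Im (k dw)] for the pullback [k] of a
    function by the exponential is closed, and its integrals over the two
    sides [t = 0] and [t = 2 pi] of a rectangle cancel by periodicity. *)
Lemma circle_integral_indep (k : C -> C) (z0 : C) (r1 r2 : R) :
  0 < r1 <= r2 ->
  (forall z, r1 <= Cmod (z - z0) <= r2 -> holomorphic_at k z) ->
  RInt (fun t => Re (k (z0 + circ r1 t)%C)) 0 (2 * PI) =
  RInt (fun t => Re (k (z0 + circ r2 t)%C)) 0 (2 * PI).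
Proof.
move=> [r10 r12] hk; have PI0 := PI_RGT_0.
have hs : ln r1 <= ln r2 by apply: ln_le.
have hks s t : ln r1 <= s <= ln r2 -> holomorphic_at k (z0 + circ (exp s) t)%C.
  move=> [s1 s2]; apply: hk.
  have -> : (z0 + circ (exp s) t - z0)%C = circ (exp s) t by ring.
  rewrite Cmod_circ; last exact: Rlt_le (exp_pos s).
  by split; [rewrite -(exp_ln r1) //|rewrite -(exp_ln r2); last lra];
    apply: exp_le_mono.
have := goursat_rectangle (fun s t => Im (k (z0 + circ (exp s) t)%C))
  (fun s t => Re (k (z0 + circ (exp s) t)%C)) (ln r1) (ln r2) 0 (2 * PI) hs
  ltac:(lra).
have H : forall s t, ln r1 <= s <= ln r2 -> 0 <= t <= 2 * PI -> exists p q m,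
    differentiable_pt_lim (fun s t => Im (k (z0 + circ (exp s) t)%C)) s t p q /\
    differentiable_pt_lim (fun s t => Re (k (z0 + circ (exp s) t)%C)) s t q m.
  move=> s t hst _; have [l /is_Cderive_comp_exp [h1 h2]] := hks s t hst.
  by do 3 eexists; split; [exact: h2|exact: h1].
move=> /(_ H); rewrite /rect_circulation.
rewrite (RInt_ext _ (fun _ => 0)); last first.
  by move=> s _; rewrite circ_2PI; ring_R.
rewrite !exp_ln; [|lra|lra].
rewrite RInt_const -[scal _ _]/(_ * 0) Rmult_0_r Rplus_0_l.
have ex r : r1 <= r <= r2 -> ex_RInt (fun t => Re (k (z0 + circ r t)%C)) 0 (2 * PI).
  move=> hr; apply: ex_RInt_continuous => t _.
  apply: continuous_Re_circle; first lra.
  by rewrite -(exp_ln r); [apply: hks; split; apply: ln_le|]; lra.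
rewrite (RInt_minus (V := R_CompleteNormedModule)); [|by apply: ex; lra|by apply: ex; lra].
by rewrite /minus /plus /opp /=; lra.
Qed.

Definition diff_quotient (g : C -> C) (z0 z : C) : C :=
  ((g z - g z0) * / (z - z0))%C.

Lemma holomorphic_diff_quotient (g : C -> C) (z0 z : C) :
  holomorphic_at g z -> z <> z0 -> holomorphic_at (diff_quotient g z0) z.
Proof.
move=> hg zz0; apply: holomorphic_mult.
  by apply: holomorphic_sub => //; apply: holomorphic_cst.
apply: holomorphic_inv; last first.
  by apply: holomorphic_sub; [apply: holomorphic_id|apply: holomorphic_cst].
have e : z = (z - z0 + z0)%C by ring.
by move=> h; apply: zz0; rewrite [LHS]e h; ring.
Qed.

(** Cauchy's formula for the derivative at the center of a circle.  The mean of
    the difference quotient does not depend on the radius, and tends to the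
    derivative when the radius tends to 0. *)
Lemma derivative_circle_integral (g : C -> C) (z0 l : C) (r : R) :
  0 < r -> is_Cderive g z0 l ->
  (forall z, Cmod (z - z0) <= r -> holomorphic_at g z) ->
  RInt (fun t => Re (diff_quotient g z0 (z0 + circ r t)%C)) 0 (2 * PI)
  = 2 * PI * Re l.
Proof.
move=> r0 /is_Cderive_eps hl hg; have PI0 := PI_RGT_0.
set J := RInt _ _ _; set k := diff_quotient g z0.
have hk z : 0 < Cmod (z - z0) <= r -> holomorphic_at k z.
  move=> hz; apply: holomorphic_diff_quotient; first by apply: hg; lra.
  move=> e; move: hz; rewrite e.
  have -> : (z0 - z0)%C = 0 by ring.
  rewrite Cmod_0; lra.
have close eps : 0 < eps -> Rabs (J - 2 * PI * Re l) <= eps * (2 * PI).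
  move=> eps0; have [del del0 hdel] := hl eps eps0.
  have [r1 [r10 r1r r1d]] : exists r1, [/\ 0 < r1, r1 <= r & r1 < del].
    exists (Rmin r (del / 2)); split; first by apply: Rmin_glb_lt; lra.
      exact: Rmin_l.
    by apply: Rle_lt_trans (Rmin_r _ _) _; lra.
  have -> : J = RInt (fun t => Re (k (z0 + circ r1 t)%C)) 0 (2 * PI).
    by rewrite (circle_integral_indep k z0 r1 r) // => z hz; apply: hk; lra.
  have := RInt_near_const (fun t => Re (k (z0 + circ r1 t)%C)) (Re l) eps 0 (2 * PI).
  rewrite Rminus_0_r (Rmult_comm (Re l)); apply; first lra.
    move=> t _; apply: continuous_Re_circle => //; apply: hk.
    have -> : (z0 + circ r1 t - z0)%C = circ r1 t by ring.
    by rewrite Cmod_circ; lra.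
  move=> t _; set c := circ r1 t.
  have c0 : c <> 0 by apply: circ_neq0.
  have cm : Cmod c = r1 by apply: Cmod_circ; lra.
  have e : (z0 + c - z0)%C = c by ring.
  have := hdel (z0 + c)%C; rewrite e cm => /(_ r1d) hc.
  rewrite -[Re _ - Re l]/(Re (k (z0 + c) - l)%C).
  apply: Rle_trans (re_le_Cmod _) _.
  rewrite /k /diff_quotient e.
  have -> : ((g (z0 + c) - g z0) * / c - l = (g (z0 + c) - g z0 - c * l) * / c)%C by field.
  rewrite Cmod_mult Cmod_inv // cm; apply: (Rmult_le_reg_r r1) => //.
  by rewrite Rmult_assoc Rinv_l ?Rmult_1_r //; lra.
case: (Req_dec J (2 * PI * Re l)) => // nz.
have h0 := Rabs_pos_lt _ (Rminus_eq_contra _ _ nz).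
have e0 : 0 < Rabs (J - 2 * PI * Re l) / (4 * PI) by apply: Rdiv_lt_0_compat; lra.
have := close _ e0.
have -> : Rabs (J - 2 * PI * Re l) / (4 * PI) * (2 * PI) = Rabs (J - 2 * PI * Re l) / 2.
  by field; lra.
lra.
Qed.

(** * The derivative is continuous *)

Lemma uniform_continuity_C (g : C -> C) (z0 : C) (m : R) :
  (forall z, Cmod (z - z0) <= 2 * m -> holomorphic_at g z) ->
  forall eps, 0 < eps -> exists2 del, 0 < del &
    forall z w : C,
      Rabs (Re z - Re z0) <= m -> Rabs (Im z - Im z0) <= m ->
      Rabs (Re w - Re z0) <= m -> Rabs (Im w - Im z0) <= m ->
      Rabs (Re w - Re z) < del -> Rabs (Im w - Im z) < del ->
      Cmod (g w - g z) <= 2 * eps.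
Proof.
move=> hg eps eps0; case: z0 hg => x0 y0 hg /=.
have d x y : x0 - m <= x <= x0 + m -> y0 - m <= y <= y0 + m ->
    exists l, is_Cderive g (x, y) l.
  move=> hx hy; apply: hg.
  apply: Rle_trans (Cmod_le_Rmax (x - x0) (y - y0)) _; apply: Rmult_le_compat_l; first lra.
  by apply: Rmax_lub; apply: Rabs_le; lra.
have [d1 h1] : exists del : posreal, forall x y u v,
    x0 - m <= x <= x0 + m -> y0 - m <= y <= y0 + m ->
    x0 - m <= u <= x0 + m -> y0 - m <= v <= y0 + m ->
    Rabs (u - x) < del -> Rabs (v - y) < del ->
    Rabs (Re (g (u, v)) - Re (g (x, y))) < eps.
  apply: (uniform_continuity_2d (fun x y => Re (g (x, y))) _ _ _ _ _ (mkposreal _ eps0)).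
  move=> x y hx hy; apply: differentiable_continuity_pt.
  have [l /is_Cderive_differentiable [h _]] := d x y hx hy.
  by do 2 eexists; exact: h.
have [d2 h2] : exists del : posreal, forall x y u v,
    x0 - m <= x <= x0 + m -> y0 - m <= y <= y0 + m ->
    x0 - m <= u <= x0 + m -> y0 - m <= v <= y0 + m ->
    Rabs (u - x) < del -> Rabs (v - y) < del ->
    Rabs (Im (g (u, v)) - Im (g (x, y))) < eps.
  apply: (uniform_continuity_2d (fun x y => Im (g (x, y))) _ _ _ _ _ (mkposreal _ eps0)).
  move=> x y hx hy; apply: differentiable_continuity_pt.
  have [l /is_Cderive_differentiable [_ h]] := d x y hx hy.
  by do 2 eexists; exact: h.
exists (Rmin d1 d2); first by apply: Rmin_glb_lt; apply: cond_pos.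
move=> [x y] [u v] /= /Rabs_le_between hx /Rabs_le_between hy
  /Rabs_le_between hu /Rabs_le_between hv ux vy.
have m1 := Rmin_l d1 d2; have m2 := Rmin_r d1 d2.
apply: Rle_trans (Cmod_le_Rmax (Re (g (u, v)) - Re (g (x, y)))
  (Im (g (u, v)) - Im (g (x, y)))) _.
apply: Rmult_le_compat_l; first lra.
apply: Rmax_lub; apply: Rlt_le; first by apply: h1; lra.
by apply: h2; lra.
Qed.

(** On a circle of fixed radius around a moving center, the difference quotient
    depends uniformly continuously on the center, so its mean, which is the
    derivative, is continuous. *)
Lemma C_derive_Re_continuous (g : C -> C) (z0 : C) (rho : R) :
  0 < rho -> (forall z, Cmod (z - z0) < rho -> holomorphic_at g z) ->
  continuity_2d_pt (fun x y => Re (C_derive g (x, y))) (Re z0) (Im z0).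
Proof.
move=> rho0 hg eps; have PI0 := PI_RGT_0; have eps0 := cond_pos eps.
(* Centers within [r] of [z0] and circles of radius [r] around them stay in the
   square of half side [m], which lies in the disk. *)
pose m := rho / 3; pose r := m / 2.
have m0 : 0 < m by rewrite /m; lra.
have r0 : 0 < r by rewrite /r; lra.
have hg2 z : Cmod (z - z0) <= 2 * m -> holomorphic_at g z.
  by move=> hz; apply: hg; rewrite /m in hz; lra.
have e0 : 0 < eps * r / 8 by nra.
have [del del0 hdel] := uniform_continuity_C g z0 m hg2 _ e0.
have hd : 0 < Rmin del (r / 2) by apply: Rmin_glb_lt; lra.
exists (mkposreal _ hd) => u v hu hv; rewrite /= in hu hv.
have m1 := Rmin_l del (r / 2); have m2 := Rmin_r del (r / 2).
set w : C := (u, v).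
have formula y : Cmod (y - z0) <= r ->
    (forall t, 0 <= t <= 2 * PI ->
       continuous (fun t => Re (diff_quotient g y (y + circ r t)%C)) t) /\
    RInt (fun t => Re (diff_quotient g y (y + circ r t)%C)) 0 (2 * PI)
    = 2 * PI * Re (C_derive g y).
  move=> hy.
  have hgy z : Cmod (z - y) <= r -> holomorphic_at g z.
    move=> hz; apply: hg2.
    have -> : (z - z0 = (z - y) + (y - z0))%C by ring.
    have := Cmod_triangle (z - y) (y - z0); rewrite /r in hy hz *; lra.
  split=> [t _|].
    apply: continuous_Re_circle => //; apply: holomorphic_diff_quotient.
      apply: hgy; have -> : (y + circ r t - y = circ r t)%C by ring.
      by rewrite Cmod_circ; lra.
    move=> e; apply: (circ_neq0 r t r0).
    have -> : circ r t = (y + circ r t - y)%C by ring.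
    by rewrite e; ring.
  apply: derivative_circle_integral => //.
  apply: (C_derive_correct g y 0); apply: hgy.
  have -> : (y - y = 0)%C by ring.
  by rewrite Cmod_0; lra.
have z00 : Cmod (z0 - z0) <= r.
  have -> : (z0 - z0 = 0)%C by ring.
  by rewrite Cmod_0; lra.
have [c0 f0] := formula z0 z00.
have hw : Cmod (w - z0) <= r.
  apply: Rle_trans (Cmod_le_Rmax (u - Re z0) (v - Im z0)) _.
  by have := Rmax_lub _ _ (r / 2) (Rlt_le _ _ (Rlt_le_trans _ _ _ hu m2))
    (Rlt_le _ _ (Rlt_le_trans _ _ _ hv m2)); lra.
have [cw fw] := formula w hw.
have key t : Rabs (Re (diff_quotient g w (w + circ r t)%C)
                 - Re (diff_quotient g z0 (z0 + circ r t)%C)) <= eps / 2.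
  set c := circ r t.
  have c0' : c <> 0 by apply: circ_neq0.
  have cm : Cmod c = r by apply: Cmod_circ; lra.
  rewrite -[Re _ - Re _]/(Re (diff_quotient g w (w + c) - diff_quotient g z0 (z0 + c))%C).
  apply: Rle_trans (re_le_Cmod _) _; rewrite /diff_quotient.
  have -> : (w + c - w = c)%C by ring.
  have -> : (z0 + c - z0 = c)%C by ring.
  have -> : ((g (w + c) - g w) * / c - (g (z0 + c) - g z0) * / c
             = ((g (w + c) - g (z0 + c)) + (- (g w - g z0))) * / c)%C by field.
  rewrite Cmod_mult Cmod_inv // cm; apply: (Rmult_le_reg_r r) => //.
  rewrite Rmult_assoc Rinv_l ?Rmult_1_r; last lra.
  apply: Rle_trans (Cmod_triangle _ _) _; rewrite Cmod_opp.
  have rc := re_le_Cmod c; have ic := im_le_Cmod c; rewrite cm in rc ic.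
  have hc : Rabs (Re c) <= r /\ Rabs (Im c) <= r by [].
  have hr : r = m / 2 by [].
  have Rew : Re w = u by [].
  have Imw : Im w = v by [].
  have b1 : Cmod (g w - g z0) <= 2 * (eps * r / 8).
    by apply: hdel; rewrite ?Rminus_diag ?Rabs_R0 ?Rew ?Imw; lra.
  have b2 : Cmod (g (w + c)%C - g (z0 + c)%C) <= 2 * (eps * r / 8).
    have E1 : Re (w + c)%C - Re (z0 + c)%C = u - Re z0 by rewrite /Re /=; ring.
    have E2 : Im (w + c)%C - Im (z0 + c)%C = v - Im z0 by rewrite /Im /=; ring.
    have E3 : Re (z0 + c)%C - Re z0 = Re c by rewrite /Re /=; ring.
    have E4 : Im (z0 + c)%C - Im z0 = Im c by rewrite /Im /=; ring.
    have E5 : Re (w + c)%C - Re z0 = (u - Re z0) + Re c by rewrite /Re /=; ring.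
    have E6 : Im (w + c)%C - Im z0 = (v - Im z0) + Im c by rewrite /Im /=; ring.
    have := Rabs_triang (u - Re z0) (Re c); have := Rabs_triang (v - Im z0) (Im c).
    by move=> ? ?; apply: hdel; rewrite ?E1 ?E2 ?E3 ?E4 ?E5 ?E6; lra.
  lra.
have := RInt_near_const (fun t => Re (diff_quotient g w (w + circ r t)%C)
   - Re (diff_quotient g z0 (z0 + circ r t)%C)) 0 (eps / 2) 0 (2 * PI).
have -> : RInt (fun t => Re (diff_quotient g w (w + circ r t)%C)
   - Re (diff_quotient g z0 (z0 + circ r t)%C)) 0 (2 * PI)
   = 2 * PI * (Re (C_derive g w) - Re (C_derive g z0)).
  rewrite (RInt_minus (V := R_CompleteNormedModule)).
  - by rewrite fw f0 /minus /plus /opp /=; ring.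
  - by apply: ex_RInt_continuous => t; rewrite Rmin_left ?Rmax_right; [exact: cw|lra|lra].
  - by apply: ex_RInt_continuous => t; rewrite Rmin_left ?Rmax_right; [exact: c0|lra|lra].
have P20 : 0 <= 2 * PI by lra.
move=> /(_ P20) H.
have {H} := H (fun t ht => continuousB _ _ _ (cw t ht) (c0 t ht)).
have k' t : 0 <= t <= 2 * PI -> Rabs (Re (diff_quotient g w (w + circ r t)%C)
                 - Re (diff_quotient g z0 (z0 + circ r t)%C) - 0) <= eps / 2.
  by move=> _; rewrite Rminus_0_r.
move=> /(_ k'); rewrite Rmult_0_l !Rminus_0_r Rabs_mult (Rabs_pos_eq (2 * PI)) //.
rewrite Rmult_comm => /Rmult_le_reg_r H.
have {H} := H ltac:(lra).
have -> : (Re z0, Im z0) = z0 by case: (z0).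
by rewrite -/w; lra.
Qed.

Lemma C_derive_continuous (g : C -> C) (z0 : C) (rho : R) :
  0 < rho -> (forall z, Cmod (z - z0) < rho -> holomorphic_at g z) ->
  continuity_2d_pt (fun x y => Re (C_derive g (x, y))) (Re z0) (Im z0) /\
  continuity_2d_pt (fun x y => Im (C_derive g (x, y))) (Re z0) (Im z0).
Proof.
move=> rho0 hg; split; first exact: C_derive_Re_continuous hg.
(* The imaginary part of [g] is the real part of [- i g]. *)
have hig z : Cmod (z - z0) < rho -> holomorphic_at (fun w => - Ci * g w)%C z.
  by move=> hz; apply: holomorphic_mult; [apply: holomorphic_cst|apply: hg].
have h := C_derive_Re_continuous _ _ _ rho0 hig.
apply: continuity_2d_pt_ext_loc h.
have d2 : 0 < rho / 2 by lra.
exists (mkposreal _ d2) => u v hu hv; rewrite /= in hu hv.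
have hz : Cmod ((u, v) - z0)%C < rho.
  apply: Rle_lt_trans (Cmod_le_Rmax (u - Re z0) (v - Im z0)) _.
  by have := Rmax_lub_lt _ _ _ hu hv; lra.
have D := C_derive_correct g (u, v) 0 (hg _ hz).
have -> : C_derive (fun w => - Ci * g w)%C (u, v)
    = (0 * g (u, v) + - Ci * C_derive g (u, v))%C.
  apply: is_C_derive_unique; apply: is_Cderive_mult D.
  exact: (is_derive_const (K := C_AbsRing) (V := C_NormedModule)).
by rewrite /Re /Im /=; ring.
Qed.

(** * Differentiating the parametrization *)

Definition is_curve_derive (gam : R -> C) (t : R) (v : C) : Prop :=
  is_derive (fun s => Re (gam s)) t (Re v) /\
  is_derive (fun s => Im (gam s)) t (Im v).

Lemma curve_derive_comp (k : C -> C) (gam : R -> C) (t : R) (l v : C) :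
  is_Cderive k (gam t) l -> is_curve_derive gam t v ->
  is_curve_derive (fun s => k (gam s)) t (l * v)%C.
Proof.
move=> /is_Cderive_differentiable [h1 h2] [/is_derive_Reals d1 /is_derive_Reals d2].
have pair s : (Re (gam s), Im (gam s)) = gam s by case: (gam s).
split.
- apply: (is_derive_ext (fun s => Re (k (Re (gam s), Im (gam s))))).
    by move=> s; rewrite pair.
  apply/is_derive_Reals.
  have -> : Re (l * v)%C = Re l * Re v + - Im l * Im v by rewrite /Re /Im /=; ring.
  exact: (derivable_pt_lim_comp_2d _ _ _ _ _ _ _ _ h1 d1 d2).
- apply: (is_derive_ext (fun s => Im (k (Re (gam s), Im (gam s))))).
    by move=> s; rewrite pair.
  apply/is_derive_Reals.
  have -> : Im (l * v)%C = Im l * Re v + Re l * Im v by rewrite /Re /Im /=; ring.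
  exact: (derivable_pt_lim_comp_2d _ _ _ _ _ _ _ _ h2 d1 d2).
Qed.

Lemma curve_derive_continuous (gam : R -> C) (t : R) (v : C) :
  is_curve_derive gam t v ->
  continuous (fun s => Re (gam s)) t /\ continuous (fun s => Im (gam s)) t.
Proof.
by move=> [d1 d2]; split; apply: ex_derive_continuous; [exists (Re v)|exists (Im v)].
Qed.

Lemma curve_derive_affine (gam : R -> C) (u w s : R) (v : C) :
  is_curve_derive gam (u * s + w) v ->
  is_curve_derive (fun s => gam (u * s + w)) s (u * v)%C.
Proof.
move=> [d1 d2].
have da : is_derive (fun s => u * s + w) s u by auto_derive => //; ring.
split.
- rewrite re_scal_l.
  exact: (is_derive_comp (fun s => Re (gam s)) (fun s => u * s + w) s _ _ d1 da).
- rewrite im_scal_l.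
  exact: (is_derive_comp (fun s => Im (gam s)) (fun s => u * s + w) s _ _ d2 da).
Qed.

Lemma is_curve_derive_R (gam : R -> C) (t : R) (v : C) :
  is_curve_derive gam t v ->
  is_derive (K := R_AbsRing) (V := C_R_NormedModule) gam t v.
Proof.
move=> [d1 d2].
have e1 := is_derive_scal_l (V := C_R_NormedModule) _ t _ (1, 0) d1.
have e2 := is_derive_scal_l (V := C_R_NormedModule) _ t _ (0, 1) d2.
have E (z : C) : plus (scal (Re z) ((1, 0) : C_R_NormedModule))
                      (scal (Im z) ((0, 1) : C_R_NormedModule)) = z.
  case: z => x y; rewrite /Re /Im /plus /scal /= /prod_plus /prod_scal /plus /scal /=.
  by rewrite /mult /=; congr pair; ring.
rewrite -(E v); apply: (is_derive_ext _ _ _ _ _ (is_derive_plus _ _ _ _ _ e1 e2)) => s.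
exact: E.
Qed.

Lemma continuous_C (gam : R -> C) (t : R) :
  continuous (fun s => Re (gam s)) t -> continuous (fun s => Im (gam s)) t ->
  continuous (T := R_UniformSpace) (U := C_UniformSpace) gam t.
Proof.
move=> c1 c2; apply/filterlim_locally => eps.
move/filterlim_locally: c1 => /(_ eps) c1; move/filterlim_locally: c2 => /(_ eps) c2.
by apply: filter_and c1 c2.
Qed.

Lemma continuousM (u v : R -> R) (x : R) :
  continuous u x -> continuous v x -> continuous (fun x => u x * v x) x.
Proof. by move=> hu hv; apply: (continuous_mult (K := R_AbsRing)). Qed.

(** [d (Re (int h dz)) = Re (h dz)]: the fundamental theorem of calculus along
    a curve, each short piece of which is reparametrized by the unit interval. *)
Lemma re_integral_derive (h : C -> C) (f : C -> R) (gam dgam : R -> C) (t0 eps : R) :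
  0 < eps -> is_re_integral h f ->
  (forall t, Rabs (t - t0) < eps ->
     [/\ in_punctured_disk (gam t), holomorphic_at h (gam t),
         is_curve_derive gam t (dgam t),
         continuous (fun t => Re (dgam t)) t &
         continuous (fun t => Im (dgam t)) t]) ->
  is_derive (fun t => f (gam t)) t0 (Re (h (gam t0) * dgam t0)%C).
Proof.
move=> eps0 hf hgam; pose F t := Re (h (gam t) * dgam t)%C.
have cF t : Rabs (t - t0) < eps -> continuous F t.
  move=> /hgam [_ [l hl] dg c1 c2].
  have [c3 c4] := curve_derive_continuous _ _ _ (curve_derive_comp _ _ _ _ _ hl dg).
  by apply: continuousB; apply: continuousM.
have iF t : Rabs (t - t0) < eps -> ex_RInt F t0 t.
  move=> ht; apply: ex_RInt_continuous => s hs; apply: cF.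
  move: hs; rewrite /Rmin /Rmax; case: Rle_dec => h1 hs;
    by move/Rabs_lt_between': ht => ht; apply: Rabs_def1; lra.
have incr t : Rabs (t - t0) < eps -> f (gam t) - f (gam t0) = RInt F t0 t.
  move=> ht; set u := t - t0 in ht *.
  have seg s : 0 <= s <= 1 -> Rabs (u * s + t0 - t0) < eps.
    move=> hs; have -> : u * s + t0 - t0 = u * s by ring.
    rewrite Rabs_mult (Rabs_pos_eq s); last lra.
    have := Rabs_pos u; nra.
  have := hf (fun s => gam (u * s + t0)) (fun s => Cmult u (dgam (u * s + t0))).
  have cond s : 0 <= s <= 1 -> [/\ in_punctured_disk (gam (u * s + t0)),
      is_derive (K := R_AbsRing) (V := C_R_NormedModule)
        (fun s => gam (u * s + t0)) s (Cmult u (dgam (u * s + t0)))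
    & continuous (T := R_UniformSpace) (U := C_UniformSpace)
        (fun s => Cmult u (dgam (u * s + t0))) s].
    move=> /seg /hgam [pd _ dg c1 c2]; split=> //.
      exact/is_curve_derive_R/curve_derive_affine.
    have ca : continuous (fun s => u * s + t0) s.
      by apply: ex_derive_continuous; auto_derive.
    apply: continuous_C.
      apply: (continuous_ext (fun s => u * Re (dgam (u * s + t0)))).
        by move=> x; rewrite re_scal_l.
      apply: continuousM; first exact: continuous_const.
      exact: (continuous_comp (fun s => u * s + t0) (fun t => Re (dgam t))).
    apply: (continuous_ext (fun s => u * Im (dgam (u * s + t0)))).
      by move=> x; rewrite im_scal_l.
    apply: continuousM; first exact: continuous_const.
    exact: (continuous_comp (fun s => u * s + t0) (fun t => Im (dgam t))).
  move=> /(_ cond).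
  have -> : u * 1 + t0 = t by rewrite /u; ring.
  have -> : u * 0 + t0 = t0 by ring.
  move=> /is_RInt_unique <-.
  have E : is_RInt F (u * 0 + t0) (u * 1 + t0) (RInt F t0 t).
    have -> : u * 1 + t0 = t by rewrite /u; ring.
    have -> : u * 0 + t0 = t0 by ring.
    by apply: RInt_correct; apply: iF.
  rewrite -(is_RInt_unique _ _ _ _ (is_RInt_comp_lin _ _ _ _ _ _ E)).
  apply: RInt_ext => s _; rewrite /F /scal /= /mult /=; ring.
have near : locally t0 (fun t => Rabs (t - t0) < eps).
  by exists (mkposreal _ eps0) => t ht.
apply: (is_derive_ext_loc (fun t => plus (f (gam t0)) (RInt F t0 t))).
  by apply: filter_imp near => t /incr <-; rewrite /plus /=; ring.
rewrite -[Re _]plus_zero_l; apply: is_derive_plus; first exact: is_derive_const.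
apply: (is_derive_RInt F _ t0 t0).
  by apply: filter_imp near => t ht; apply: RInt_correct; apply: iF.
by apply: cF; rewrite Rminus_diag Rabs_R0.
Qed.

Lemma circ_derive (r t : R) : is_curve_derive (circ r) t (Ci * circ r t)%C.
Proof. by split; rewrite /circ /Re /Im /=; auto_derive => //; ring. Qed.

Lemma in_punctured_disk_near (z : C) : in_punctured_disk z ->
  exists2 eps, 0 < eps & forall w, Cmod (w - z) < eps -> in_punctured_disk w.
Proof.
move=> [z0 z1]; exists (Rmin (Cmod z) (1 - Cmod z)); first by apply: Rmin_glb_lt; lra.
move=> w hw.
have h1 := Rlt_le_trans _ _ _ hw (Rmin_l _ _).
have h2 := Rlt_le_trans _ _ _ hw (Rmin_r _ _).
have := Cmod_triangle (w - z) z; have := Cmod_triangle (z - w) w.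
have -> : (w - z + z = w)%C by ring.
have -> : (z - w + w = z)%C by ring.
by rewrite (Cmod_opp_sub z); rewrite /in_punctured_disk; lra.
Qed.

Section Parametrization.

Variables (d : nat) (h : 'I_d -> C -> C) (f : C -> vec d).
Hypothesis h_holo : forall (k : 'I_d) (z : C),
  in_punctured_disk z -> holomorphic_at (h k) z.
Hypothesis hf : forall k : 'I_d, is_re_integral (h k) (fun z => f z k).

Lemma f_xE (z : C) (k : 'I_d) : in_punctured_disk z -> f_x f z k = Re (h k z).
Proof.
move=> hz; have [eps eps0 heps] := in_punctured_disk_near z hz.
apply: is_derive_unique.
have Ez : (Re z, Im z) = z by case: (z).
have := re_integral_derive (h k) (fun z => f z k) (fun x => (x, Im z)) (fun _ => 1)
  (Re z) eps eps0 (hf k).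
rewrite Ez Cmult_1_r; apply=> t ht.
have pd : in_punctured_disk (t, Im z).
  apply: heps; rewrite -{2}Ez -[(_ - _)%C]/(t - Re z, Im z - Im z) Rminus_diag.
  by rewrite -[(t - Re z, 0)]/(RtoC (t - Re z)) Cmod_R.
split=> //; try exact: continuous_const; first exact: h_holo.
by split; rewrite /Re /Im /=; auto_derive.
Qed.

Lemma f_yE (z : C) (k : 'I_d) : in_punctured_disk z -> f_y f z k = - Im (h k z).
Proof.
move=> hz; have [eps eps0 heps] := in_punctured_disk_near z hz.
apply: is_derive_unique.
have Ez : (Re z, Im z) = z by case: (z).
have := re_integral_derive (h k) (fun z => f z k) (fun y => (Re z, y)) (fun _ => Ci)
  (Im z) eps eps0 (hf k).
rewrite Ez re_mult_Ci; apply=> t ht.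
have pd : in_punctured_disk (Re z, t).
  apply: heps; rewrite -{2}Ez -[(_ - _)%C]/(Re z - Re z, t - Im z) Rminus_diag.
  have -> : (0, t - Im z) = (Ci * RtoC (t - Im z))%C.
    by rewrite /Ci /RtoC /Cmult /=; congr pair; ring.
  by rewrite Cmod_mult Cmod_Ci Cmod_R Rmult_1_l.
split=> //; try exact: continuous_const; first exact: h_holo.
by split; rewrite /Re /Im /=; auto_derive.
Qed.

Lemma f_circ_derive (r t : R) (k : 'I_d) : 0 < r < 1 ->
  is_derive (fun s => f (circ r s) k) t (Re (h k (circ r t) * (Ci * circ r t))%C).
Proof.
move=> hr.
apply: (re_integral_derive (h k) (fun z => f z k) (circ r)
  (fun s => Ci * circ r s)%C t 1) => //; first lra.
move=> s _.
have pd : in_punctured_disk (circ r s) by rewrite /in_punctured_disk Cmod_circ; lra.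
split=> //; [exact: h_holo|exact: circ_derive| |];
  by apply: ex_derive_continuous; rewrite /circ /Re /Im /=; auto_derive.
Qed.

End Parametrization.

(** * Continuously differentiable functions and winding *)

Definition C1 (u du : R -> R) : Prop :=
  forall t, is_derive u t (du t) /\ continuous du t.

Lemma C1_continuous (u du : R -> R) (t : R) : C1 u du -> continuous u t.
Proof. by move=> /(_ t) [h _]; apply: ex_derive_continuous; exists (du t). Qed.

Lemma continuousD (u v : R -> R) (x : R) :
  continuous u x -> continuous v x -> continuous (fun x => u x + v x) x.
Proof. by move=> hu hv; apply: (continuous_plus (V := R_NormedModule)). Qed.

Lemma continuous_div (u v : R -> R) (x : R) :
  v x <> 0 -> continuous u x -> continuous v x ->
  continuous (fun x => u x / v x) x.
Proof.
move=> vx hu hv; apply: continuousM => //.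
exact: (continuous_comp v Rinv _ hv (continuous_Rinv _ vx)).
Qed.

Lemma C1_add (u v du dv : R -> R) :
  C1 u du -> C1 v dv -> C1 (fun t => u t + v t) (fun t => du t + dv t).
Proof.
move=> hu hv t; have [du' cu] := hu t; have [dv' cv] := hv t.
by split; [apply: (is_derive_plus (V := R_NormedModule))|apply: continuousD].
Qed.

Lemma C1_sub (u v du dv : R -> R) :
  C1 u du -> C1 v dv -> C1 (fun t => u t - v t) (fun t => du t - dv t).
Proof.
move=> hu hv t; have [du' cu] := hu t; have [dv' cv] := hv t.
by split; [apply: (is_derive_minus (V := R_NormedModule))|apply: continuousB].
Qed.

Lemma C1_mul (u v du dv : R -> R) :
  C1 u du -> C1 v dv ->
  C1 (fun t => u t * v t) (fun t => du t * v t + u t * dv t).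
Proof.
move=> hu hv t; have [du' cu] := hu t; have [dv' cv] := hv t.
have c1 := C1_continuous _ _ t hu; have c2 := C1_continuous _ _ t hv.
split; last by apply: continuousD; apply: continuousM.
by apply: (is_derive_mult (K := R_AbsRing)) => //; exact: Rmult_comm.
Qed.

Lemma C1_sqrt (u du : R -> R) :
  C1 u du -> (forall t, 0 < u t) ->
  C1 (fun t => sqrt (u t)) (fun t => du t / (2 * sqrt (u t))).
Proof.
move=> hu u0 t; have [du' cu] := hu t; have s0 := sqrt_lt_R0 _ (u0 t).
split.
  auto_derive; first by split; [exists (du t)|split].
  by rewrite (is_derive_unique _ _ _ du') /=; field; lra.
apply: continuous_div => //; first lra.
apply: continuousM; first exact: continuous_const.
exact: (continuous_comp u sqrt _ (C1_continuous _ _ t hu) (continuous_sqrt _)).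
Qed.

Lemma C1_dot (d : nat) (u v du dv : R -> vec d) :
  (forall k, C1 (fun t => u t k) (fun t => du t k)) ->
  (forall k, C1 (fun t => v t k) (fun t => dv t k)) ->
  C1 (fun t => dot (u t) (v t)) (fun t => dot (du t) (v t) + dot (u t) (dv t)).
Proof.
move=> hu hv; rewrite /dot.
elim: (index_enum _) => [|k s IH] t.
  split.
    apply: (is_derive_ext (fun _ => 0)); first by move=> x; rewrite big_nil.
    by rewrite !big_nil Rplus_0_r; apply: is_derive_const.
  apply: (continuous_ext (fun _ => 0)); first by move=> x; rewrite !big_nil Rplus_0_r.
  exact: continuous_const.
have [h c] := C1_add _ _ _ _ (C1_mul _ _ _ _ (hu k) (hv k)) IH t.
split.
  apply: (is_derive_ext (fun t => u t k * v t k + \big[Rplus/0]_(j <- s) (u t j * v t j))).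
    by move=> x; rewrite big_cons.
  rewrite !big_cons; move: h; congr is_derive => //=; ring.
apply: continuous_ext c => x; rewrite !big_cons /=; ring.
Qed.

(** The derivative of the argument of [p + i q]: twice the arctangent below is
    the principal argument, defined off the nonpositive reals. *)
Lemma argument_derive (p q : R -> R) (t dp dq : R) :
  is_derive p t dp -> is_derive q t dq -> 0 < sqrt (p t ^ 2 + q t ^ 2) + p t ->
  is_derive (fun t => 2 * atan (q t / (sqrt (p t ^ 2 + q t ^ 2) + p t))) t
    ((p t * dq - q t * dp) / (p t ^ 2 + q t ^ 2)).
Proof.
move=> hp hq pos.
have sq : 0 < p t ^ 2 + q t ^ 2.
  case: (Rle_lt_dec (p t ^ 2 + q t ^ 2) 0) => // H.
  by move: pos; rewrite sqrt_neg_0 //; nra.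
have s0 := sqrt_lt_R0 _ sq; have ss := sqrt_sqrt _ (Rlt_le _ _ sq).
have E : p t * (p t * 1) + q t * (q t * 1) = p t ^ 2 + q t ^ 2 by ring.
auto_derive; rewrite !E.
  by do !split; try (by exists dp); try (by exists dq); lra.
rewrite !(is_derive_unique _ _ _ hp) !(is_derive_unique _ _ _ hq).
move: s0 ss pos; rewrite -!E; set s := sqrt _ => s0 ss pos.
have u0 : s + p t <> 0 by lra.
have q2 : q t * q t = s * s - p t * p t by lra.
have -> : 1 + q t * / (s + p t) * (q t * / (s + p t) * 1) = 2 * s / (s + p t).
  have -> : 1 + q t * / (s + p t) * (q t * / (s + p t) * 1)
            = ((s + p t) * (s + p t) + q t * q t) / ((s + p t) * (s + p t)) by field.
  by rewrite q2; field.
rewrite -ss; field_simplify_eq; last by split; lra.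
ring [q2].
Qed.

(** A closed curve that avoids the half-line of nonpositive reals does not wind
    around the origin. *)
Lemma winding_slit_plane (p q dp dq : R -> R) (T : R) :
  C1 p dp -> C1 q dq -> (forall t, 0 < sqrt (p t ^ 2 + q t ^ 2) + p t) ->
  p T = p 0 -> q T = q 0 ->
  (forall t, continuous (fun t => (p t * dq t - q t * dp t) / (p t ^ 2 + q t ^ 2)) t) /\
  is_RInt (fun t => (p t * dq t - q t * dp t) / (p t ^ 2 + q t ^ 2)) 0 T 0.
Proof.
move=> hp hq pos pT qT.
have cint t : continuous (fun t => (p t * dq t - q t * dp t) / (p t ^ 2 + q t ^ 2)) t.
  have cp := C1_continuous _ _ t hp; have cq := C1_continuous _ _ t hq.
  have [_ cdp] := hp t; have [_ cdq] := hq t.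
  apply: continuous_div.
  - move=> z; have := pos t; rewrite z sqrt_0; nra.
  - by apply: continuousB; apply: continuousM.
  - apply: continuousD; rewrite /=; repeat apply: continuousM => //; exact: continuous_const.
split=> //.
have := is_RInt_derive (V := R_CompleteNormedModule)
  (fun t => 2 * atan (q t / (sqrt (p t ^ 2 + q t ^ 2) + p t))) _ 0 T
  (fun t _ => argument_derive p q t _ _ (proj1 (hp t)) (proj1 (hq t)) (pos t))
  (fun t _ => cint t).
by rewrite pT qT /minus /plus /opp /= Rplus_opp_r.
Qed.

(** * Inner products *)

Lemma dot_ge0 (d : nat) (u : vec d) : 0 <= dot u u.
Proof.
rewrite /dot; apply: (big_ind (fun x => 0 <= x)); first lra.
  by move=> x y; lra.
by move=> k _; apply: Rle_0_sqr.
Qed.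

Lemma dot_cauchy_schwarz (d : nat) (u v : vec d) :
  dot u v ^ 2 <= dot u u * dot v v.
Proof.
have key a b : 0 <= a * a * dot u u + 2 * (a * b) * dot u v + b * b * dot v v.
  have := dot_ge0 d (fun k => a * u k + b * v k).
  by rewrite dot_linear !(dotC _ (fun k => a * u k + b * v k)) !dot_linear (dotC v u); lra.
case: (Req_dec (dot v v) 0) => [v0|v0].
  case: (Req_dec (dot u v) 0) => [->|w0]; first by rewrite v0; lra.
  (* A multiple of [v] large enough to make the quadratic form negative. *)
  have := key 1 (- (dot u u + 1) / dot u v); rewrite v0.
  have -> : 1 * 1 * dot u u + 2 * (1 * (- (dot u u + 1) / dot u v)) * dot u v
    + - (dot u u + 1) / dot u v * (- (dot u u + 1) / dot u v) * 0 = - dot u u - 2.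
    by field.
  by have := dot_ge0 d u; lra.
have v1 : 0 < dot v v by have := dot_ge0 d v; lra.
have := key (dot v v) (- dot u v) => k1.
apply: (Rmult_le_reg_l (dot v v)) => //; lra.
Qed.

(** * Geodesic curvature in a moving frame *)

Section MovingFrame.

Variables (d : nat) (P S dP dS : R -> vec d) (X Y dX dY : R -> R).

Hypothesis hP : forall k, C1 (fun t => P t k) (fun t => dP t k).
Hypothesis hS : forall k, C1 (fun t => S t k) (fun t => dS t k).
Hypothesis hX : C1 X dX.
Hypothesis hY : C1 Y dY.
Hypothesis gram_gt0 : forall t,
  0 < dot (P t) (P t) * dot (S t) (S t) - dot (P t) (S t) ^ 2.
Hypothesis P_ge1 : forall t, 1 <= dot (P t) (P t).
Hypothesis XY_gt0 : forall t, 0 < X t ^ 2 + Y t ^ 2.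

Let v t : vec d := fun k => X t * P t k + Y t * S t k.
Let dv t : vec d := fun k => (dX t * P t k + dY t * S t k) + (X t * dP t k + Y t * dS t k).

(* [E], [F], [G] are the first fundamental form in the basis [(P, S)] and [W] is
   the area form.  The coordinates of [v] in the frame that starts with [P / |P|]
   are [a / |P|] and [b / |P|]. *)
Let E t := dot (P t) (P t).
Let F t := dot (P t) (S t).
Let G t := dot (S t) (S t).
Let W t := sqrt (E t * G t - F t ^ 2).
Let a t := X t * E t + Y t * F t.
Let b t := Y t * W t.

Definition frame_curvature t := dot (dv t) (rot90 (P t) (S t) (v t)) / dot (v t) (v t).
(** [<E1', E2>] for the frame with [E1 = P / |P|] and
    [E2 = (E S - F P) / (|P| W)]; the derivative of [1 / |P|] drops out because
    [P] is orthogonal to [E2]. *)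
Definition frame_rotation t :=
  (dot (dP t) (S t) * E t - dot (dP t) (P t) * F t) / (E t * W t).
(** The derivative of the argument of [X + i Y]. *)
Definition coordinate_rotation t :=
  (X t * dY t - Y t * dX t) / (X t ^ 2 + Y t ^ 2).

Let dE t := dot (dP t) (P t) + dot (P t) (dP t).
Let dF t := dot (dP t) (S t) + dot (P t) (dS t).
Let dG t := dot (dS t) (S t) + dot (S t) (dS t).
Let dW t := (dE t * G t + E t * dG t - (dF t * F t + F t * dF t)) / (2 * W t).
Let da t := (dX t * E t + X t * dE t) + (dY t * F t + Y t * dF t).
Let db t := dY t * W t + Y t * dW t.
(* [p + i q] is the product of [a + i b] and the conjugate of [X + i Y]. *)
Let p t := a t * X t + b t * Y t.
Let q t := b t * X t - a t * Y t.
Let dp t := (da t * X t + a t * dX t) + (db t * Y t + b t * dY t).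
Let dq t := (db t * X t + b t * dX t) - (da t * Y t + a t * dY t).

Let W_gt0 t : 0 < W t.
Proof. exact: sqrt_lt_R0 _ (gram_gt0 t). Qed.

Let WW t : W t * W t = E t * G t - F t ^ 2.
Proof. exact: sqrt_sqrt (Rlt_le _ _ (gram_gt0 t)). Qed.

Let hE : C1 E dE. Proof. exact: C1_dot. Qed.
Let hF : C1 F dF. Proof. exact: C1_dot. Qed.
Let hG : C1 G dG. Proof. exact: C1_dot. Qed.

Let hW : C1 W dW.
Proof.
have h := C1_sub _ _ _ _ (C1_mul _ _ _ _ hE hG) (C1_mul _ _ _ _ hF hF).
have pos t : 0 < E t * G t - F t * F t.
  by have := gram_gt0 t; rewrite -/(E t) -/(F t) -/(G t); nra.
move=> t; have [i1 i2] := C1_sqrt _ _ h pos t.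
have eW s : sqrt (E s * G s - F s * F s) = W s by rewrite /W; congr sqrt; ring.
split.
  by apply: (is_derive_ext (fun t => sqrt (E t * G t - F t * F t))) => //; rewrite /dW -eW.
by apply: continuous_ext i2 => s; rewrite eW.
Qed.

Let ha : C1 a da.
Proof. by apply: C1_add; apply: C1_mul. Qed.

Let hb : C1 b db.
Proof. exact: C1_mul. Qed.

Let hp : C1 p dp.
Proof. by apply: C1_add; apply: C1_mul. Qed.

Let hq : C1 q dq.
Proof. by apply: C1_sub; apply: C1_mul. Qed.

(* [p + i q] is never a nonpositive real: where [q = 0], either [Y = 0] and
   [p = X^2 E], or [p = W (X^2 + Y^2)]. *)
Let slit t : 0 < sqrt (p t ^ 2 + q t ^ 2) + p t.
Proof.
have E0 : 0 < E t by have := P_ge1 t; rewrite /E; lra.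
have hx := XY_gt0 t; have hw := W_gt0 t.
case: (Rlt_le_dec 0 (p t)) => [|p0]; first by have := sqrt_pos (p t ^ 2 + q t ^ 2); lra.
have q0 : q t <> 0.
  move=> qz; move: p0; apply: Rlt_not_le; rewrite /p.
  move: qz; rewrite /q /a /b => qz.
  case: (Req_dec (Y t) 0) => [y0|y0].
    by rewrite y0 in hx *; nra.
  have e : Y t * F t = X t * (W t - E t).
    apply: (Rmult_eq_reg_l (Y t)) => //; lra.
  rewrite e; nra.
have : sqrt (p t ^ 2) < sqrt (p t ^ 2 + q t ^ 2).
  by apply: sqrt_lt_1; have := pow2_gt_0 _ q0; have := pow2_ge_0 (p t); lra.
rewrite -(pow2_abs (p t)) sqrt_pow2; last exact: Rabs_pos.
by rewrite Rabs_left1 //; lra.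
Qed.

(* The tangent vector rotates with respect to the frame at the speed of the
   argument of [a + i b], that is, of [X + i Y] times [p + i q]. *)
Let frame_identity t :
  frame_curvature t =
  (coordinate_rotation t + (p t * dq t - q t * dp t) / (p t ^ 2 + q t ^ 2)) + frame_rotation t.
Proof.
have E0 : 0 < E t by have := P_ge1 t; rewrite /E; lra.
have hx := XY_gt0 t; have hw := W_gt0 t; have ww := WW t.
have dv1 u : dot (dv t) u = (dX t * dot (P t) u + dY t * dot (S t) u)
    + (X t * dot (dP t) u + Y t * dot (dS t) u).
  rewrite -!dot_linear -[X in _ = X + _]Rmult_1_l -[X in _ = _ + X]Rmult_1_l -dot_linear.
  by apply: eq_bigr => k _; rewrite !Rmult_1_l.
have vP : dot (v t) (P t) = X t * E t + Y t * F t.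
  by rewrite dot_linear (dotC (S t)).
have vS : dot (v t) (S t) = X t * F t + Y t * G t.
  by rewrite dot_linear.
have vv : dot (v t) (v t) = X t * X t * E t + 2 * (X t * Y t) * F t + Y t * Y t * G t.
  rewrite dot_linear !(dotC _ (v t)) vP vS; ring.
have num : dot (dv t) (rot90 (P t) (S t) (v t)) =
    (dot (v t) (P t) * dot (dv t) (S t) - dot (v t) (S t) * dot (dv t) (P t)) / W t.
  rewrite dotC.
  have -> : dot (rot90 (P t) (S t) (v t)) (dv t)
    = dot (fun k => (dot (v t) (P t) / W t) * S t k
                    + (- dot (v t) (S t) / W t) * P t k) (dv t).
    by apply: eq_bigr => k _; rewrite /rot90 -/(W t) /Rdiv; ring.
  rewrite dot_linear !(dotC _ (dv t)); field; lra.
rewrite /frame_curvature num vv !dv1 vP vS /frame_rotation /coordinate_rotation.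
rewrite /p /q /dp /dq /da /db /dW /dE /dF /dG /a /b.
rewrite (dotC (S t) (P t)) (dotC (P t) (dP t)) (dotC (P t) (dS t)) (dotC (S t) (dS t)).
rewrite -/(E t) -/(F t) -/(G t).
(* Eliminating [G] turns the relation [W^2 = E G - F^2] into a definition. *)
have G_E : G t = (W t * W t + F t ^ 2) / E t by rewrite ww; field; lra.
rewrite G_E.
move: (E t) (F t) (W t) (X t) (Y t) (dX t) (dY t) E0 hw hx
  (dot (dP t) (P t)) (dot (dP t) (S t)) (dot (dS t) (P t)) (dot (dS t) (S t)).
clear.
move=> E F W X Y dX dY E0 W0 XY pp ps sp ss.
have h1 : 0 < (X * E + Y * F) ^ 2 + (Y * W) ^ 2.
  case: (Req_dec Y 0) => y0.
    rewrite y0 in XY *.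
    have X0 : 0 < X ^ 2 by lra.
    by have := Rmult_lt_0_compat _ _ X0 (pow_lt _ 2 E0); nra.
  have := pow2_gt_0 (Y * W) ltac:(apply: Rmult_integral_contrapositive; lra).
  by have := pow2_ge_0 (X * E + Y * F); lra.
field.
have -> : ((X * E + Y * F) * X + Y * W * Y) ^ 2 + (Y * W * X - (X * E + Y * F) * Y) ^ 2
   = ((X * E + Y * F) ^ 2 + (Y * W) ^ 2) * (X ^ 2 + Y ^ 2) by ring.
have -> : (X * X * E + 2 * (X * Y) * F) * E + Y * Y * (W * W + F ^ 2)
   = (X * E + Y * F) ^ 2 + (Y * W) ^ 2 by ring.
by have := Rmult_lt_0_compat _ _ h1 XY; do !split; lra.
Qed.

(** The frame rotates at most as fast as [P / |P|] moves, and [|P| >= 1]. *)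
Lemma frame_rotation_le (t K : R) :
  0 <= K -> dot (dP t) (dP t) <= K ^ 2 -> Rabs (frame_rotation t) <= K.
Proof.
move=> K0 hK; have E1 := P_ge1 t; rewrite -/(E t) in E1.
have w0 := W_gt0 t; have ww := WW t.
pose V : vec d := fun k => E t * S t k + (- F t) * P t k.
have dV : dot (dP t) V = dot (dP t) (S t) * E t - dot (dP t) (P t) * F t.
  by rewrite dotC dot_linear !(dotC _ (dP t)); ring.
have VV : dot V V = E t * (W t * W t).
  rewrite {1}/V dot_linear !(dotC _ V) /V !dot_linear (dotC (S t) (P t)).
  by rewrite -/(E t) -/(F t) -/(G t) ww; ring.
have cs := dot_cauchy_schwarz _ (dP t) V.
have EW0 : 0 < E t * W t by apply: Rmult_lt_0_compat; lra.
rewrite /frame_rotation -dV Rabs_div; last lra.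
rewrite (Rabs_pos_eq (E t * W t)); last lra.
apply: (Rmult_le_reg_r (E t * W t)) => //.
rewrite /Rdiv Rmult_assoc Rinv_l ?Rmult_1_r; last lra.
apply: Rsqr_incr_0_var; last by apply: Rmult_le_pos; lra.
rewrite -Rsqr_abs !Rsqr_pow2; apply: Rle_trans cs _; rewrite VV.
have W2 : 0 < W t * W t by nra.
have : E t * (W t * W t) <= (E t * W t) ^ 2 by nra.
have := pow2_ge_0 K; have := Rmult_le_compat_r (E t * (W t * W t)) _ _ ltac:(nra) hK.
by move=> *; nra.
Qed.

(** The geodesic curvature is the rotation of the tangent vector with respect
    to an orthonormal frame plus the rotation of that frame.  The frame starts
    with [P / |P|].  In it, the argument of the tangent vector differs from the
    argument of [X + i Y] by less than [pi], because the change of coordinates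
    is upper triangular with positive diagonal; hence both make the same number
    of turns. *)
Lemma frame_total_curvature (T K M e : R) :
  0 <= T -> 0 <= K -> P T = P 0 -> S T = S 0 -> X T = X 0 -> Y T = Y 0 ->
  (forall t, dot (dP t) (dP t) <= K ^ 2) ->
  (forall t, Rabs (coordinate_rotation t - M) <= e) ->
  ex_RInt frame_curvature 0 T /\
  Rabs (RInt frame_curvature 0 T - M * T) <= (e + K) * T.
Proof.
move=> T0 K0 PT ST XT YT hK hM.
have ET : E T = E 0 by rewrite /E PT.
have FT : F T = F 0 by rewrite /F PT ST.
have WT : W T = W 0 by rewrite /W ET FT /G ST.
have aT : a T = a 0 by rewrite /a XT YT ET FT.
have bT : b T = b 0 by rewrite /b YT WT.
have [] := winding_slit_plane p q dp dq T hp hq slit.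
- by rewrite /p aT bT XT YT.
- by rewrite /q aT bT XT YT.
move=> cw iw.
have cc t : continuous coordinate_rotation t.
  have cX := C1_continuous _ _ t hX; have cY := C1_continuous _ _ t hY.
  have [_ cdX] := hX t; have [_ cdY] := hY t.
  apply: continuous_div; first by have := XY_gt0 t; lra.
    by apply: continuousB; apply: continuousM.
  apply: continuousD; rewrite /=; repeat apply: continuousM => //; exact: continuous_const.
have cr t : continuous frame_rotation t.
  have cE := C1_continuous _ _ t hE; have cF := C1_continuous _ _ t hF.
  have cW := C1_continuous _ _ t hW.
  have cdot (u : R -> vec d) : (forall k, continuous (fun t => u t k) t) ->
      continuous (fun t => dot (dP t) (u t)) t.
    move=> cu; rewrite /dot; elim: (index_enum _) => [|k s IH].
      apply: (continuous_ext (fun _ => 0)); first by move=> x; rewrite big_nil.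
      exact: continuous_const.
    apply: (continuous_ext
      (fun t => dP t k * u t k + \big[Rplus/0]_(j <- s) (dP t j * u t j))).
      by move=> x; rewrite big_cons.
    by apply: continuousD => //; apply: continuousM => //; case: (hP k t).
  apply: continuous_div.
  - have := P_ge1 t; rewrite -/(E t) => E1; have := W_gt0 t => w0.
    by apply: Rgt_not_eq; apply: Rmult_lt_0_compat; lra.
  - apply: continuousB; apply: continuousM => //; apply: cdot => k.
      exact: C1_continuous (hS k).
    exact: C1_continuous (hP k).
  - exact: continuousM.
have icr : ex_RInt (fun t => coordinate_rotation t + frame_rotation t) 0 T.
  by apply: ex_RInt_continuous => t _; apply: continuousD.
have main : is_RInt frame_curvature 0 T
    (RInt (fun t => coordinate_rotation t + frame_rotation t) 0 T).
  rewrite -[RInt _ _ _]plus_zero_r.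
  apply: (is_RInt_ext (fun t => plus (coordinate_rotation t + frame_rotation t)
     ((p t * dq t - q t * dp t) / (p t ^ 2 + q t ^ 2)))).
    by move=> t _; rewrite frame_identity /plus /=; ring.
  by apply: is_RInt_plus => //; apply: RInt_correct.
split; first by eexists; exact: main.
rewrite (is_RInt_unique _ _ _ _ main).
have := RInt_near_const (fun t => coordinate_rotation t + frame_rotation t) M (e + K) 0 T T0.
rewrite Rminus_0_r; apply=> t _; first exact: continuousD.
have -> : coordinate_rotation t + frame_rotation t - M
  = (coordinate_rotation t - M) + frame_rotation t by ring.
apply: Rle_trans (Rabs_triang _ _) _; apply: Rplus_le_compat => //.
exact: frame_rotation_le.
Qed.

End MovingFrame.

(** * Powers and curves on a circle *)

Lemma Cpowz_succ (z : C) (a : Z) : z <> 0 -> Cpowz z (a + 1) = (Cpowz z a * z)%C.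
Proof.
move=> z0; case: a => [|p|p].
- by rewrite /= Cmult_1_l Cmult_1_r.
- by rewrite -Pos2Z.inj_add /Cpowz Pos2Nat.inj_add Cpow_add_r Cpow_1_r.
- have zp q : (z ^ q)%C <> 0 by apply: Cpow_nz.
  case: (Pos.succ_pred_or p) => [->|<-].
    by rewrite /= Cmult_1_r Cinv_l.
  move: (Pos.pred p) => q.
  have -> : (Z.neg (Pos.succ q) + 1 = Z.neg q)%Z by lia.
  rewrite /Cpowz Pos2Nat.inj_succ Cpow_S.
  by field; split.
Qed.

Lemma Cpowz_add_nat (z : C) (a : Z) (m : nat) :
  z <> 0 -> Cpowz z (a + Z.of_nat m) = (Cpowz z a * z ^ m)%C.
Proof.
move=> z0; elim: m => [|m IH]; first by rewrite Z.add_0_r /= Cmult_1_r.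
have -> : (a + Z.of_nat m.+1 = a + Z.of_nat m + 1)%Z by lia.
by rewrite Cpowz_succ // IH Cpow_S; ring.
Qed.

(** De Moivre's formula for positive and negative exponents. *)
Lemma Cpowz_circ (r t : R) (a : Z) : 0 < r ->
  Cpowz (circ r t) a = (powerRZ r a * circ 1 (IZR a * t))%C.
Proof.
move=> r0; have z0 := circ_neq0 r t r0.
have rot b : (circ 1 (IZR b * t) * circ r t = r * circ 1 (IZR (b + 1) * t))%C.
  rewrite plus_IZR Rmult_plus_distr_r Rmult_1_l /circ cos_plus sin_plus.
  by rewrite /Cmult /RtoC /=; congr pair; ring.
have pS b : powerRZ r (b + 1) = powerRZ r b * r.
  by rewrite powerRZ_add ?powerRZ_1; lra.
have step b : (powerRZ r b * circ 1 (IZR b * t) * circ r t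
               = powerRZ r (b + 1) * circ 1 (IZR (b + 1) * t))%C.
  by rewrite pS RtoC_mult -Cmult_assoc rot; ring.
elim/Z.peano_ind: a => [|b IH|b IH].
- by rewrite /circ !Rmult_0_l cos_0 sin_0 !Rmult_1_r Rmult_0_r /= Cmult_1_l.
- by rewrite -Z.add_1_r Cpowz_succ // IH step.
- have : (Cpowz (circ r t) (Z.pred b) * circ r t
          = powerRZ r (Z.pred b) * circ 1 (IZR (Z.pred b) * t) * circ r t)%C.
    by rewrite -Cpowz_succ // step -Z.sub_1_r Z.sub_add.
  move=> H; have : (Cpowz (circ r t) (Z.pred b) * circ r t * / circ r t
    = powerRZ r (Z.pred b) * circ 1 (IZR (Z.pred b) * t) * circ r t * / circ r t)%C.
    by rewrite H.
  by rewrite -!Cmult_assoc Cinv_r // !Cmult_1_r.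
Qed.

Definition curve_C1 (gam dgam : R -> C) : Prop :=
  C1 (fun t => Re (gam t)) (fun t => Re (dgam t)) /\
  C1 (fun t => Im (gam t)) (fun t => Im (dgam t)).

Lemma curve_C1_mul (gam del dgam ddel : R -> C) :
  curve_C1 gam dgam -> curve_C1 del ddel ->
  curve_C1 (fun t => gam t * del t)%C (fun t => dgam t * del t + gam t * ddel t)%C.
Proof.
have cast u u' du du' : C1 u du -> u =1 u' -> du =1 du' -> C1 u' du'.
  move=> h eu edu t; have [h1 h2] := h t; rewrite -edu; split.
    exact: is_derive_ext h1.
  exact: continuous_ext h2.
move=> [g1 g2] [d1 d2]; split.
- apply: cast (C1_sub _ _ _ _ (C1_mul _ _ _ _ g1 d1) (C1_mul _ _ _ _ g2 d2)) _ _ => t /=;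
    by rewrite ?re_mult /Re /Im /=; ring.
- apply: cast (C1_add _ _ _ _ (C1_mul _ _ _ _ g1 d2) (C1_mul _ _ _ _ g2 d1)) _ _ => t /=;
    by rewrite /Re /Im /=; ring.
Qed.

Lemma curve_C1_cst (c : C) : curve_C1 (fun _ => c) (fun _ => 0).
Proof.
by split=> t; split; (exact: is_derive_const || exact: continuous_const).
Qed.

Lemma curve_C1_turn (M : R) :
  curve_C1 (fun t => circ 1 (M * t)) (fun t => M * (Ci * circ 1 (M * t)))%C.
Proof.
by split=> t; split; rewrite /circ /Re /Im /=;
  [auto_derive => //; ring| |auto_derive => //; ring|];
  apply: ex_derive_continuous; auto_derive.
Qed.

Lemma curve_C1_circle (g : C -> C) (r rho : R) :
  0 <= r < rho -> (forall z, Cmod z < rho -> holomorphic_at g z) ->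
  curve_C1 (fun t => g (circ r t)) (fun t => C_derive g (circ r t) * (Ci * circ r t))%C.
Proof.
move=> hr hg.
have hz t : Cmod (circ r t) < rho by rewrite Cmod_circ; lra.
have D t : is_curve_derive (fun t => g (circ r t)) t
    (C_derive g (circ r t) * (Ci * circ r t))%C.
  apply: curve_derive_comp (circ_derive r t).
  by apply: (C_derive_correct g _ 0); apply: hg.
have [c1 c2] : (forall t, continuous (fun t => Re (circ r t)) t) /\
               (forall t, continuous (fun t => Im (circ r t)) t).
  by split=> t; apply: ex_derive_continuous; rewrite /circ /Re /Im /=; auto_derive.
have [e1 e2] : (forall t, continuous (fun t => Re (C_derive g (circ r t))) t) /\
               (forall t, continuous (fun t => Im (C_derive g (circ r t))) t).
  have cont t :
     continuity_2d_pt (fun x y => Re (C_derive g (x, y))) (Re (circ r t)) (Im (circ r t)) /\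
     continuity_2d_pt (fun x y => Im (C_derive g (x, y))) (Re (circ r t)) (Im (circ r t)).
    apply: (C_derive_continuous g (circ r t) (rho - r)); first lra.
    move=> z hzz; apply: hg; have := Cmod_triangle (z - circ r t) (circ r t).
    have -> : (z - circ r t + circ r t = z)%C by ring.
    by rewrite Cmod_circ; lra.
  split=> t; have [/continuity_2d_pt_filterlim k1 /continuity_2d_pt_filterlim k2] := cont t.
    exact: (continuous_comp_2 _ _ (fun x y => Re (C_derive g (x, y))) t (c1 t) (c2 t) k1).
  exact: (continuous_comp_2 _ _ (fun x y => Im (C_derive g (x, y))) t (c1 t) (c2 t) k2).
have m t : continuous (fun t => - Im (circ r t)) t.
  apply: (continuous_ext (fun t => (-1) * Im (circ r t))) => [x|]; first ring_R.
  by apply: continuousM => //; apply: continuous_const.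
split=> t; (split; first by case: (D t)).
- apply: (continuous_ext (fun t => Re (C_derive g (circ r t)) * (- Im (circ r t))
     - Im (C_derive g (circ r t)) * Re (circ r t))).
    by move=> x; rewrite /Re /Im /=; ring.
  by apply: continuousB; apply: continuousM.
- apply: (continuous_ext (fun t => Re (C_derive g (circ r t)) * Re (circ r t)
     + Im (C_derive g (circ r t)) * (- Im (circ r t)))).
    by move=> x; rewrite /Re /Im /=; ring.
  by apply: continuousD; apply: continuousM.
Qed.

Lemma C_derive_bounded (g : C -> C) (rho : R) :
  0 < rho -> (forall z, Cmod z < rho -> holomorphic_at g z) ->
  exists K, 0 <= K /\
    exists2 del, 0 < del & forall z, Cmod z < del -> Cmod (C_derive g z) <= K.
Proof.
move=> rho0 hg.
have [|c1 c2] := C_derive_continuous g 0 rho rho0.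
  move=> z; have -> : (z - 0 = z)%C by ring.
  exact: hg.
have [d1 h1] := c1 (mkposreal _ Rlt_0_1).
have [d2 h2] := c2 (mkposreal _ Rlt_0_1).
set l := C_derive g 0.
exists (2 * (Cmod l + 1)); split; first by have := Cmod_ge_0 l; lra.
exists (Rmin d1 d2); first by apply: Rmin_glb_lt; apply: cond_pos.
move=> z hz.
have m1 := Rmin_l d1 d2; have m2 := Rmin_r d1 d2.
have r1 := re_le_Cmod z; have r2 := im_le_Cmod z.
have Ez : (Re z, Im z) = z by case: (z).
have i1 : Rabs (Re (C_derive g z) - Re l) < 1.
  by rewrite -[z in C_derive g z]Ez; apply: h1; rewrite Rminus_0_r; lra.
have i2 : Rabs (Im (C_derive g z) - Im l) < 1.
  by rewrite -[z in C_derive g z]Ez; apply: h2; rewrite Rminus_0_r; lra.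
have := Cmod_le_Rmax (Re (C_derive g z)) (Im (C_derive g z)).
have -> : (Re (C_derive g z), Im (C_derive g z)) = C_derive g z by case: (C_derive g z).
move/Rle_trans; apply; apply: Rmult_le_compat_l; first lra.
have a1 := Rabs_triang_inv (Re (C_derive g z)) (Re l).
have a2 := Rabs_triang_inv (Im (C_derive g z)) (Im l).
have b1 := re_le_Cmod l; have b2 := im_le_Cmod l.
by apply: Rmax_lub; lra.
Qed.

(** * Linear algebra of tangent planes *)

Lemma dot_term_le (d : nat) (u : vec d) (k : 'I_d) : u k * u k <= dot u u.
Proof.
rewrite /dot; have : k \in index_enum 'I_d by rewrite mem_index_enum.
elim: (index_enum _) => [//|j s IH]; rewrite in_cons big_cons.
have s0 : 0 <= \big[Rplus/0]_(j <- s) (u j * u j).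
  apply: (big_ind (fun x => 0 <= x)); first lra.
    by move=> x y; lra.
  by move=> i _; apply: Rle_0_sqr.
move: s0 IH; set B := \big[_/_]_(i <- s) _ => s0 IH.
case/orP => [/eqP ->|/IH h]; first lra.
by have := Rle_0_sqr (u j); rewrite /Rsqr; lra.
Qed.

Lemma dot_le (d : nat) (u w : vec d) :
  (forall k, Rabs (u k) <= w k) -> dot u u <= dot w w.
Proof.
move=> h; rewrite /dot; apply: (big_ind2 (fun x y => x <= y)); first lra.
  by move=> x1 x2 y1 y2; lra.
move=> k _; have := h k; have := Rabs_pos (u k).
rewrite -[u k * u k]/(Rsqr (u k)) Rsqr_abs /Rsqr; nra.
Qed.

Lemma filter_forall_ord (T : Type) (F : (T -> Prop) -> Prop) (d : nat)
    (A : 'I_d -> T -> Prop) :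
  Filter F -> (forall k, F (A k)) -> F (fun x => forall k, A k x).
Proof.
move=> FF h.
have : F (fun x => forall k, k \in index_enum 'I_d -> A k x).
  elim: (index_enum _) => [|j s IH]; first exact: filter_forall.
  apply: filter_imp (filter_and _ _ (h j) IH) => x [hj hs] k.
  by rewrite in_cons => /orP [/eqP ->|/hs].
by apply: filter_imp => x hx k; apply: hx; rewrite mem_index_enum.
Qed.

(** The rotation by a right angle depends only on the oriented plane; a complex
    linear change of the parameter keeps both. *)
Lemma rot90_similarity (d : nat) (P S v : vec d) (a b : R) :
  0 < a * a + b * b -> 0 < dot P P * dot S S - dot P S ^ 2 ->
  rot90 (fun k => a * P k + b * S k) (fun k => - b * P k + a * S k) v
  =1 rot90 P S v.
Proof.
move=> D0 gr k; rewrite /rot90.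
set u1 : vec d := fun k => a * P k + b * S k.
set u2 : vec d := fun k => - b * P k + a * S k.
have s0 := sqrt_lt_R0 _ gr.
have w1 w : dot u1 w = a * dot P w + b * dot S w by rewrite dot_linear.
have w2 w : dot u2 w = - b * dot P w + a * dot S w by rewrite dot_linear.
have -> : dot u1 u1 * dot u2 u2 - dot u1 u2 ^ 2
  = (a * a + b * b) ^ 2 * (dot P P * dot S S - dot P S ^ 2).
  by rewrite !w1 !w2 !(dotC _ u1) !(dotC _ u2) !w1 !w2 (dotC S P); ring.
rewrite sqrt_mult; [|exact: pow2_ge_0|lra].
rewrite sqrt_pow2; last lra.
rewrite !(dotC v) w1 w2 /u1 /u2; field; lra.
Qed.

Lemma immersion_gram_gt0 (d : nat) (f : C -> vec d) (z : C) (P S : vec d)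
    (a b : R) (k0 : 'I_d) :
  is_immersion f -> in_punctured_disk z -> P k0 = 1 -> 0 < a * a + b * b ->
  (forall k, f_x f z k = a * P k + b * S k) ->
  (forall k, f_y f z k = - b * P k + a * S k) ->
  0 < dot P P * dot S S - dot P S ^ 2.
Proof.
move=> imm hz P1 D0 fx fy; case: (Rlt_le_dec 0 (dot P P * dot S S - dot P S ^ 2)) => // gr.
have E1 : 0 < dot P P by have := dot_term_le d P k0; rewrite P1; lra.
(* Equality in the Cauchy-Schwarz inequality: [V] vanishes, and expressing it by
   [f_x] and [f_y] contradicts the injectivity of [df]. *)
pose V : vec d := fun k => dot P P * S k + (- dot P S) * P k.
have VV : dot V V = dot P P * (dot P P * dot S S - dot P S ^ 2).
  have w u : dot V u = dot P P * dot S u + (- dot P S) * dot P u by rewrite dot_linear.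
  by rewrite w !(dotC _ V) !w (dotC S P); ring.
have V0 k : V k = 0.
  have := dot_term_le d V k; rewrite VV => h1.
  have : V k * V k <= 0 by apply: Rle_trans h1 _; nra.
  by have := Rle_0_sqr (V k); rewrite /Rsqr => *; apply: Rsqr_0_uniq; rewrite /Rsqr; lra.
have [] := imm z hz (- dot P S * a + dot P P * b) (dot P P * a + dot P S * b).
  move=> k; rewrite fx fy; have := V0 k; rewrite /V => v0.
  have -> : (- dot P S * a + dot P P * b) * (a * P k + b * S k)
     + (dot P P * a + dot P S * b) * (- b * P k + a * S k)
     = (a * a + b * b) * (dot P P * S k + - dot P S * P k) by ring.
  by rewrite v0; ring.
move=> x0 y0.
have : dot P P * (a * a + b * b) = 0.
  have -> : dot P P * (a * a + b * b) = (- dot P S * a + dot P P * b) * b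
     + (dot P P * a + dot P S * b) * a by ring.
  by rewrite x0 y0; ring.
nra.
Qed.

(** * The puncture *)

Lemma functional_choice_epsilon (A B : Type) (R : A -> B -> Prop) :
  (forall x, exists y, R x y) -> exists f, forall x, R x (f x).
Proof.
move=> H; exists (fun x => proj1_sig (constructive_indefinite_description _ (H x))) => x.
exact: proj2_sig.
Qed.

Lemma holomorphic_lower_bound (g : C -> C) : holomorphic_at g 0 -> g 0 <> 0 ->
  exists2 del, 0 < del & forall z, Cmod z < del -> Cmod (g 0) / 2 <= Cmod (g z).
Proof.
move=> [l /is_Cderive_eps /(_ 1 Rlt_0_1) [del del0 hdel]] g00.
have m0 : 0 < Cmod (g 0) by apply/Cmod_gt_0.
have l0 := Cmod_ge_0 l.
(* Since [|g z - g 0| <= (1 + |l|) |z|] near 0, this radius keeps the change of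
   [g] below half of [|g 0|]. *)
pose c := Cmod (g 0) / (2 * (1 + Cmod l)).
have c0 : 0 < c by apply: Rdiv_lt_0_compat; lra.
exists (Rmin del c); first exact: Rmin_glb_lt.
move=> z hz.
have h1 := Rlt_le_trans _ _ _ hz (Rmin_l _ _).
have h2 := Rlt_le_trans _ _ _ hz (Rmin_r _ _).
have z0 : (z - 0 = z)%C by ring.
have := hdel z; rewrite z0 => /(_ h1) h3.
have t1 := Cmod_triangle (g z) (- (g z - g 0 - z * l) - z * l)%C.
have t2 := Cmod_triangle (- (g z - g 0 - z * l))%C (- (z * l))%C.
rewrite !Cmod_opp Cmod_mult in t2.
have e : (g z + (- (g z - g 0 - z * l) - z * l) = g 0)%C by ring.
rewrite e in t1.
have : Cmod z * (1 + Cmod l) <= c * (1 + Cmod l) by apply: Rmult_le_compat_r; lra.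
have -> : c * (1 + Cmod l) = Cmod (g 0) / 2 by rewrite /c; field; lra.
rewrite /Cminus in t1 t2 h3 *; lra.
Qed.

(** Dividing all coefficients by one of maximal pole order leaves holomorphic
    quotients. *)
Lemma common_pole_factor (d : nat) (h : 'I_d -> C -> C) (n : 'I_d -> Z) (N : Z) :
  (forall k, pole_order_at0 (h k) (n k)) -> is_max n N ->
  exists (g0 : C -> C) (Q : 'I_d -> C -> C) (k0 : 'I_d) (m rho : R),
  [/\ 0 < m /\ 0 < rho,
      forall z, Cmod z < rho -> holomorphic_at g0 z /\ m <= Cmod (g0 z),
      forall k z, Cmod z < rho -> holomorphic_at (Q k) z,
      forall z, Cmod z < rho -> Q k0 z = 1 &
      forall k z, 0 < Cmod z < rho -> h k z = (g0 z * Cpowz z (- N) * Q k z)%C].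
Proof.
move=> hp [hmax [k0 hk0]].
have [rh /functional_choice_epsilon [g hg]] := functional_choice_epsilon _ _ _ hp.
have [r0 hol0 g00 _] := hg k0.
have [del del0 hdel] : exists2 del, 0 < del &
    forall z, Cmod z < del -> Cmod (g k0 0) / 2 <= Cmod (g k0 z).
  by apply: holomorphic_lower_bound => //; apply: hol0; rewrite Cmod_0.
have m0 : 0 < Cmod (g k0 0) / 2 by have : 0 < Cmod (g k0 0) by [apply/Cmod_gt_0]; lra.
have [rho [rho0 hrho]] : exists rho, 0 < rho /\ forall k, rho <= rh k.
  have /filter_forall_ord : forall k, at_right 0 (fun x => x <= rh k).
    move=> k; have [rk _ _ _] := hg k; exists (mkposreal _ rk) => x hx _.
    have : Rabs (x - 0) < rh k by exact: hx.
    by move=> /Rabs_def2; lra.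
  case=> eps H; exists (eps / 2); have e0 := cond_pos eps; split; first lra.
  move=> k; apply: H; last lra.
  have : Rabs (eps / 2 - 0) < eps by apply: Rabs_def1; lra.
  exact.
exists (g k0), (fun k z => g k z * / g k0 z * z ^ Z.to_nat (N - n k))%C, k0,
  (Cmod (g k0 0) / 2), (Rmin rho del).
have low z : Cmod z < Rmin rho del -> Cmod z < rho /\ Cmod z < del.
  by move=> hz; split; apply: Rlt_le_trans hz _; [apply: Rmin_l|apply: Rmin_r].
have nz z : Cmod z < Rmin rho del -> g k0 z <> 0.
  by move=> /low [_ hz]; apply/Cmod_gt_0; have := hdel z hz; lra.
have hol k z : Cmod z < Rmin rho del -> holomorphic_at (g k) z.
  by move=> /low [hz _]; have [_ H _ _] := hg k; apply: H; have := hrho k; lra.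
split.
- by split=> //; apply: Rmin_glb_lt.
- by move=> z hz; split; [exact: hol|apply: hdel; case: (low z hz)].
- move=> k z hz; apply: holomorphic_mult; last exact: holomorphic_pow.
  apply: holomorphic_mult; first exact: hol.
  by apply: holomorphic_inv; [exact: nz|exact: hol].
- by move=> z hz; rewrite hk0 Z.sub_diag /= Cmult_1_r Cinv_r //; exact: nz.
- move=> k z hz; have [_ _ _ hk] := hg k; rewrite hk; last first.
    by have [hz' _] := low z (proj2 hz); have := hrho k; lra.
  have z0 : z <> 0 by apply/Cmod_gt_0; lra.
  have -> : (- n k = - N + Z.of_nat (Z.to_nat (N - n k)))%Z.
    by rewrite Z2Nat.id; have := hmax k; lia.
  rewrite Cpowz_add_nat //; have := nz z (proj2 hz) => gz.
  by field.
Qed.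

(** The two rotations of the moving frame argument on one small circle, where
    [e] bounds [|z g'/g|] and [K] bounds [|P'|]. *)
Lemma circle_total_curvature (d : nat) (h : 'I_d -> C -> C) (f : C -> vec d)
    (N : Z) (g0 : C -> C) (Q : 'I_d -> C -> C) (k0 : 'I_d) (rho r e K : R) :
  (forall k z, in_punctured_disk z -> holomorphic_at (h k) z) ->
  (forall k, is_re_integral (h k) (fun z => f z k)) ->
  is_immersion f ->
  (forall z, Cmod z < rho -> holomorphic_at g0 z /\ g0 z <> 0) ->
  (forall k z, Cmod z < rho -> holomorphic_at (Q k) z) ->
  (forall z, Cmod z < rho -> Q k0 z = 1) ->
  (forall k z, 0 < Cmod z < rho -> h k z = (g0 z * Cpowz z (- N) * Q k z)%C) ->
  0 < r < rho -> r < 1 -> 0 <= K ->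
  (forall z, Cmod z = r -> Cmod (C_derive g0 z * z / g0 z)%C <= e) ->
  (forall t, let z := circ r t in
     let dP : vec d := fun k => Re (C_derive (Q k) z * (Ci * z))%C in
     dot dP dP <= K ^ 2) ->
  ex_RInt (geodesic_curvature_density f r) 0 (2 * PI) /\
  Rabs (RInt (geodesic_curvature_density f r) 0 (2 * PI) - (1 - IZR N) * (2 * PI))
    <= (e + K) * (2 * PI).
Proof.
move=> hh hf imm hg0 hQ hQ1 hhQ hr r1 K0 he hK.
have PI0 := PI_RGT_0.
have hc t : Cmod (circ r t) = r by apply: Cmod_circ; lra.
have pd t : in_punctured_disk (circ r t) by rewrite /in_punctured_disk hc; lra.
have crho t : Cmod (circ r t) < rho by rewrite hc; lra.
pose M := 1 - IZR N.
pose c := powerRZ r (1 - N).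
have c0 : 0 < c by apply: powerRZ_lt; lra.
(* [zeta = i z h_0] is the complex number [X + i Y], written in polar form so
   that its derivative shows the constant speed [M]. *)
pose zeta t := (c * Ci * (g0 (circ r t) * circ 1 (M * t)))%C.
pose dzeta t := (0 * (g0 (circ r t) * circ 1 (M * t)) + c * Ci *
  (C_derive g0 (circ r t) * (Ci * circ r t) * circ 1 (M * t)
   + g0 (circ r t) * (M * (Ci * circ 1 (M * t)))))%C.
have [hX hY] : curve_C1 zeta dzeta.
  apply: curve_C1_mul; first exact: curve_C1_cst.
  apply: curve_C1_mul; last exact: curve_C1_turn.
  by apply: (curve_C1_circle g0 r rho); [lra|move=> z /hg0 []].
pose q t k := Q k (circ r t).
pose dq t k := (C_derive (Q k) (circ r t) * (Ci * circ r t))%C.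
have hq k : curve_C1 (fun t => q t k) (fun t => dq t k).
  by apply: (curve_C1_circle (Q k) r rho); [lra|exact: hQ].
pose P t : vec d := fun k => Re (q t k); pose dP t : vec d := fun k => Re (dq t k).
pose S t : vec d := fun k => - Im (q t k); pose dS t : vec d := fun k => - Im (dq t k).
have hP k : C1 (fun t => P t k) (fun t => dP t k) by case: (hq k).
have hS k : C1 (fun t => S t k) (fun t => dS t k).
  have [_ hi] := hq k; move=> t; have [h1 h2] := hi t.
  split; first exact: (is_derive_opp (V := R_NormedModule)).
  exact: (continuous_opp (V := R_NormedModule)).
pose X t := Re (zeta t); pose Y t := Im (zeta t).
pose dX t := Re (dzeta t); pose dY t := Im (dzeta t).
pose h0 z := (g0 z * Cpowz z (- N))%C.
have h0E k t : h k (circ r t) = (h0 (circ r t) * q t k)%C.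
  by apply: hhQ; rewrite hc; lra.
have zetaE t : zeta t = (h0 (circ r t) * (Ci * circ r t))%C.
  have z0 := circ_neq0 r t (proj1 hr).
  have E : (Cpowz (circ r t) (- N) * circ r t = c * circ 1 (M * t))%C.
    rewrite -Cpowz_succ // Cpowz_circ; last lra.
    by rewrite Z.add_comm Z.add_opp_r minus_IZR.
  have -> : zeta t = (Ci * g0 (circ r t) * (c * circ 1 (M * t)))%C by rewrite /zeta; ring.
  by rewrite -E /h0; ring.
have tang t k : (h k (circ r t) * (Ci * circ r t) = zeta t * q t k)%C.
  by rewrite h0E zetaE; ring.
pose al z := Re (h0 z); pose be z := Im (h0 z).
have fx t k : f_x f (circ r t) k = al (circ r t) * P t k + be (circ r t) * S t k.
  by rewrite (f_xE d h f hh hf) // h0E re_mult /al /be /P /S; ring.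
have fy t k : f_y f (circ r t) k = - be (circ r t) * P t k + al (circ r t) * S t k.
  by rewrite (f_yE d h f hh hf) // h0E im_mult /al /be /P /S; ring.
have h0nz t : 0 < al (circ r t) * al (circ r t) + be (circ r t) * be (circ r t).
  have : 0 < Cmod (h0 (circ r t)) ^ 2.
    apply: pow_lt; rewrite /h0 Cmod_mult; apply: Rmult_lt_0_compat.
      by apply/Cmod_gt_0; case: (hg0 _ (crho t)).
    rewrite Cpowz_circ ?Cmod_mult ?Cmod_circ ?Cmod_R ?Rmult_1_r; [|lra|lra].
    by apply: Rabs_pos_lt; apply: powerRZ_NOR; lra.
  by rewrite Cmod2_alt /al /be; lra.
have gr t : 0 < dot (P t) (P t) * dot (S t) (S t) - dot (P t) (S t) ^ 2.
  apply: (immersion_gram_gt0 d f (circ r t) (P t) (S t)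
    (al (circ r t)) (be (circ r t)) k0) => //.
  by rewrite /P /q hQ1.
have P1 t : 1 <= dot (P t) (P t).
  have Pk0 : P t k0 = 1 by rewrite /P /q hQ1.
  have := dot_term_le d (P t) k0; rewrite Pk0; lra.
pose al0 t := Re (g0 (circ r t)); pose be0 t := Im (g0 (circ r t)).
pose al1 t := Re (C_derive g0 (circ r t) * (Ci * circ r t))%C.
pose be1 t := Im (C_derive g0 (circ r t) * (Ci * circ r t))%C.
have g0nz t : 0 < al0 t ^ 2 + be0 t ^ 2.
  have : 0 < Cmod (g0 (circ r t)) ^ 2.
    by apply: pow_lt; apply/Cmod_gt_0; case: (hg0 _ (crho t)).
  by rewrite Cmod2_alt.
have csn t : cos (M * t) * cos (M * t) + sin (M * t) * sin (M * t) = 1.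
  by have := sin2_cos2 (M * t); rewrite /Rsqr; lra.
have XYE t : X t ^ 2 + Y t ^ 2 = c ^ 2 * (al0 t ^ 2 + be0 t ^ 2).
  rewrite -[RHS]Rmult_1_r -(csn t) /X /Y /zeta /al0 /be0 /circ /Re /Im /=; ring.
have XY t : 0 < X t ^ 2 + Y t ^ 2.
  by rewrite XYE; apply: Rmult_lt_0_compat => //; apply: pow_lt.
have rotE t : coordinate_rotation X Y dX dY t - M
    = (al0 t * be1 t - be0 t * al1 t) / (al0 t ^ 2 + be0 t ^ 2).
  have num : X t * dY t - Y t * dX t
     = c ^ 2 * (al0 t * be1 t - be0 t * al1 t + M * (al0 t ^ 2 + be0 t ^ 2)).
    rewrite -[RHS]Rmult_1_r -(csn t) /X /Y /dX /dY /zeta /dzeta /al0 /be0 /al1 /be1.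
    move: (g0 (circ r t)) (C_derive g0 (circ r t) * (Ci * circ r t))%C => [x y] [x' y'].
    rewrite /circ /Re /Im /=; ring.
  rewrite /coordinate_rotation num XYE; have := g0nz t => ?; field; lra.
have rot_le t : Rabs (coordinate_rotation X Y dX dY t - M) <= e.
  rewrite rotE; apply: Rle_trans (he _ (hc t)).
  have -> : (al0 t * be1 t - be0 t * al1 t) / (al0 t ^ 2 + be0 t ^ 2)
     = Re (C_derive g0 (circ r t) * circ r t / g0 (circ r t))%C.
    rewrite /al1 /be1 /al0 /be0.
    have := g0nz t; rewrite /al0 /be0.
    move: (g0 (circ r t)) (C_derive g0 (circ r t)) (circ r t) => [x y] [x' y'] [u v].
    rewrite /Re /Im /= => D; field; lra.
  exact: re_le_Cmod.
have [] := frame_total_curvature d P S dP dS X Y dX dY hP hS hX hY gr P1 XY (2 * PI) K M e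
  ltac:(lra) K0.
- by rewrite /P /q circ_2PI.
- by rewrite /S /q circ_2PI.
- by rewrite /X !zetaE circ_2PI.
- by rewrite /Y !zetaE circ_2PI.
- by move=> t; have := hK t.
- exact: rot_le.
have densE : geodesic_curvature_density f r = frame_curvature d P S dP dS X Y dX dY.
  apply: functional_extensionality => t.
  have d1 s k : is_derive (fun s => f (circ r s) k) s (X s * P s k + Y s * S s k).
    have := f_circ_derive d h f hh hf r s k ltac:(lra).
    by rewrite tang re_mult /X /Y /P /S /=; congr is_derive; ring_R.
  have vel : (fun k => Derive (fun s => f (circ r s) k) t)
     = (fun k => X t * P t k + Y t * S t k).
    by apply: functional_extensionality => k; apply: is_derive_unique.
  have acc : (fun k => Derive_n (fun s => f (circ r s) k) 2 t)
     = (fun k => (dX t * P t k + dY t * S t k) + (X t * dP t k + Y t * dS t k)).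
    apply: functional_extensionality => k; rewrite /Derive_n.
    rewrite (Derive_ext _ (fun s => X s * P s k + Y s * S s k)); last first.
      by move=> s; apply: is_derive_unique.
    apply: is_derive_unique.
    have [h1 _] := C1_add _ _ _ _ (C1_mul _ _ _ _ hX (hP k)) (C1_mul _ _ _ _ hY (hS k)) t.
    by move: h1; congr is_derive; rewrite /dX /dY /X /Y; ring_R.
  have rot v : rot90 (f_x f (circ r t)) (f_y f (circ r t)) v = rot90 (P t) (S t) v.
    have -> : f_x f (circ r t) = (fun k => al (circ r t) * P t k + be (circ r t) * S t k).
      exact: functional_extensionality.
    have -> : f_y f (circ r t) = (fun k => - be (circ r t) * P t k + al (circ r t) * S t k).
      exact: functional_extensionality.
    by apply: functional_extensionality => k; apply: rot90_similarity.
  by rewrite /geodesic_curvature_density /frame_curvature vel acc rot.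
by rewrite densE.
Qed.

Lemma at_right0_lt (rho : R) : 0 < rho -> at_right 0 (fun r => 0 < r < rho).
Proof.
move=> rho0; exists (mkposreal _ rho0) => r hr r0; split=> //.
have : Rabs (r - 0) < rho by exact: hr.
by move=> /Rabs_def2; lra.
Qed.

Theorem theorem1p6 (d : nat) (h : 'I_d -> C -> C) (n : 'I_d -> Z) (N : Z)
    (f : C -> vec d)
    (hd : (3 <= d)%N)
    (h_holo : forall (k : 'I_d) (z : C),
       in_punctured_disk z -> holomorphic_at (h k) z)
    (h_pole : forall k : 'I_d, pole_order_at0 (h k) (n k))
    (h_res : forall k : 'I_d, exists c : R, is_residue_at0 (h k) (RtoC c))
    (hf : forall k : 'I_d, is_re_integral (h k) (fun z => f z k))
    (f_imm : is_immersion f)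
    (hN : is_max n N) :
  is_puncture_gauss_curvature f (- 2 * PI * (IZR N - 1)).
Proof.
have [g0 [Q [k0 [m [rho [[m0 rho0] hg0 hQ hQ1 hhQ]]]]]] :=
  common_pole_factor d h n N h_pole hN.
have [Kg [Kg0 [dg dg0 hKg]]] := C_derive_bounded g0 rho rho0 (fun z hz => proj1 (hg0 z hz)).
have [Kv hKv] := functional_choice_epsilon _ _ _
  (fun k => C_derive_bounded (Q k) rho rho0 (hQ k)).
have small : at_right 0 (fun r => forall k z, Cmod z = r ->
    Cmod (C_derive (Q k) z) <= Kv k).
  apply: filter_forall_ord => k; have [_ [del del0 hdel]] := hKv k.
  apply: filter_imp (at_right0_lt del del0) => r [_ hr] z hz.
  by apply: hdel; rewrite hz.
(* The error on the circle of radius [r] is [2 pi A r]: the first summand of [A]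
   comes from [z g'/g], the second from the rotation of the frame. *)
pose B := sqrt (dot Kv Kv).
have B0 : 0 <= B by apply: sqrt_pos.
pose A := Kg / m + B.
have A0 : 0 <= A by apply: Rplus_le_le_0_compat => //; apply: Rdiv_le_0_compat.
have est : at_right 0 (fun r => 0 < r /\
   (ex_RInt (geodesic_curvature_density f r) 0 (2 * PI) /\
    Rabs (RInt (geodesic_curvature_density f r) 0 (2 * PI) - (1 - IZR N) * (2 * PI))
      <= (A * r) * (2 * PI))).
  have near : at_right 0 (fun r => 0 < r < Rmin rho (Rmin dg 1)).
    by apply: at_right0_lt; repeat apply: Rmin_glb_lt => //; lra.
  apply: filter_imp (filter_and _ _ near small) => r [[r0 hr] hs]; split=> //.
  have r1 := Rlt_le_trans _ _ _ hr (Rmin_l _ _).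
  have hr' := Rlt_le_trans _ _ _ hr (Rmin_r _ _).
  have r2 := Rlt_le_trans _ _ _ hr' (Rmin_l _ _).
  have r3 := Rlt_le_trans _ _ _ hr' (Rmin_r _ _).
  have -> : A * r = Kg / m * r + B * r by rewrite /A; ring.
  apply: (circle_total_curvature d h f N g0 Q k0 rho) => //.
  - move=> z hz; have [hh hm] := hg0 z hz; split=> //.
    by apply/Cmod_gt_0; lra.
  - by apply: Rmult_le_pos => //; lra.
  - move=> z hz; have [_ hm] := hg0 z ltac:(lra).
    have gz : g0 z <> 0 by apply/Cmod_gt_0; lra.
    rewrite /Cdiv !Cmod_mult Cmod_inv // hz.
    have -> : Kg / m * r = Kg * r * / m by field; lra.
    apply: Rmult_le_compat.
    + by apply: Rmult_le_pos; [apply: Cmod_ge_0|lra].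
    + by apply/Rlt_le/Rinv_0_lt_compat; lra.
    + by apply: Rmult_le_compat_r; [lra|apply: hKg; lra].
    + exact: Rinv_le_contravar.
  - move=> t z dP.
    have zr : Cmod z = r by apply: Cmod_circ; lra.
    have -> : (B * r) ^ 2 = dot (fun k => r * Kv k + 0 * Kv k) (fun k => r * Kv k + 0 * Kv k).
      have BB : B * B = dot Kv Kv by apply/sqrt_sqrt/dot_ge0.
      rewrite dot_linear !(dotC Kv) !dot_linear -BB; ring.
    apply: dot_le => k; apply: Rle_trans (re_le_Cmod _) _.
    rewrite !Cmod_mult Cmod_Ci zr; have := hs k z zr.
    have := r0; nra.
split; first by apply: filter_imp est => r [_ []].
apply/filterlim_locally => eps; have eps0 := cond_pos eps; have PI0 := PI_RGT_0.
have D0 : 0 < eps / (A * (2 * PI) + 1).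
  by apply: Rdiv_lt_0_compat => //; nra.
apply: filter_imp (filter_and _ _ est (at_right0_lt _ D0)) => r [[r0 [_ hr]] [_ hlt]].
have target : Rabs (RInt (geodesic_curvature_density f r) 0 (2 * PI)
    - - 2 * PI * (IZR N - 1)) < eps.
  have -> : - 2 * PI * (IZR N - 1) = (1 - IZR N) * (2 * PI) by ring.
  apply: Rle_lt_trans hr _.
  have L0 : 0 < A * (2 * PI) + 1 by nra.
  have := Rmult_lt_compat_r _ _ _ L0 hlt.
  have -> : eps / (A * (2 * PI) + 1) * (A * (2 * PI) + 1) = eps by field; lra.
  nra.
exact: target.
Qed.
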